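(* Let $k\ge 2$ and let $\boldsymbol X=(X_1,\dots,X_k)^\top$ be an elliptical random vector in $\mathbb{R}^k$ with stochastic representation $\boldsymbol X\stackrel{d}{=}R\,A^\top\boldsymbol U$, where $A\in\mathbb{R}^{k\times k}$ is non-singular, $\boldsymbol U$ is uniformly distributed on the unit sphere of $\mathbb{R}^k$, and the associated random radius $R$ is almost surely positive and independent of $\boldsymbol U$. Assume that $\Sigma:=A^\top A$ is a correlation matrix (all diagonal entries equal $1$). Let $F$ be the distribution function of $R$, with $F(0)=0$ and $F(x)<1$ for all $x>0$, and assume that for some positive scaling function $w$ $$\lim_{u\to\infty}\frac{1-F(u+x/w(u))}{1-F(u)}=\exp(-x),\qquad \forall x\in\mathbb{R}.$$ If for some $\theta\in[0,\infty)$ the scaling function $w$ satisfies $$\lim_{u\to\infty}\frac{w(cu)}{w(u)}=c^{\theta-1},\qquad \forall c>0,$$ then for any non-empty index set $I\subset\{1,\dots,k\}$ with $m\le k$ elements and any $\boldsymbol x=(x_1,\dots,x_k)^\top\in(0,\infty)^k$ we have $$\lim_{u\to\infty}\frac{\widetilde S_{u,I}(\boldsymbol x)}{\widetilde S_{u,I}(\boldsymbol 1)}=\prod_{j\in K}x_j^{\gamma_j},\qquad \gamma_j:=\alpha_I^{\theta-1}\bigl(\boldsymbol e_j^\top\Sigma_{KK}^{-1}\boldsymbol 1_K\bigr)\in(0,\infty),\quad \forall j\in K,$$ where $K$ is a unique subset of $I$ with $l>0$ elements such that $\Sigma_{KK}^{-1}\boldsymbol 1_K$ is a vector with positive elements,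 and $\boldsymbol e_j$ is the $j$-th unit vector in $\mathbb{R}^l$. Furthermore, if $M:=I\setminus K$ is not empty, then the vector $\Sigma_{KM}\Sigma_{MM}^{-1}\boldsymbol 1_M-\boldsymbol 1_K$ has non-negative components, and $u\mapsto\widetilde S_{u,I}(\boldsymbol 1)$ is regularly varying (at infinity) with index $-1/\eta_I$, where $$\eta_I:=\alpha_I^{-\theta}\in\Bigl(\bigl(\boldsymbol 1_I^\top\Sigma_{II}^{-1}\boldsymbol 1_I\bigr)^{-\theta},\,1\Bigr).$$
   Context: $\stackrel{d}{=}$ denotes equality of distribution functions. Since $\Sigma$ has unit diagonal, $X_1,\dots,X_k$ all have the same distribution function, denoted $Q$, and for $u>0$ and $\boldsymbol x\in(0,\infty)^k$ $$\widetilde S_{u,I}(\boldsymbol x):=\mathbf{P}\{Q(X_i)>1-x_i/u\ \text{ for all } i\in I\}.$$ The number $\alpha_I$ is the attained minimum of the quadratic programming problem: minimise $\boldsymbol y_I^\top\Sigma_{II}^{-1}\boldsymbol y_I$ over $\boldsymbol y=(y_1,\dots,y_k)^\top\in\mathbb{R}^k$ with $y_i\ge 1$ for all $i\in I$, where $\boldsymbol y_I=(y_i,\,i\in I)^\top$. For index sets $J,L\subset\{1,\dots,k\}$, $\Sigma_{JL}$ is the submatrix of $\Sigma$ obtained by retaining the rows with indices in $J$ and the columns with indices in $L$; $\Sigma_{JJ}^{-1}$ is the inverse of $\Sigma_{JJ}$; $\boldsymbol 1$ is the vector in $\mathbb{R}^k$ with all entries $1$, and $\boldsymbol 1_J$ is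 its subvector with indices in $J$. The quantity $\boldsymbol e_j^\top\Sigma_{KK}^{-1}\boldsymbol 1_K$ is the component of $\Sigma_{KK}^{-1}\boldsymbol 1_K$ belonging to the index $j\in K$. A positive function $g$ is regularly varying at infinity with index $\gamma$ if $\lim_{u\to\infty}g(cu)/g(u)=c^\gamma$ for all $c>0$.
   Formalization: Exponents θ in γ_j, η_I and the lower bound become θ/2; K is unique by positivity plus Σ_MKΣ_KK^{-1}1_K−1_M≥0 (K, M were swapped); the interval for η_I is closed, with η_I<1 if θ>0, m>1, and strict lower bound if θ>0 and Σ_MKΣ_KK^{-1}1_K≠1_M. *)

(* Defs.v *)
From HB Require Import structures.
From mathcomp Require Export all_boot all_order all_algebra.
From mathcomp Require Export all_classical all_reals all_analysis.
Set Implicit Arguments.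
Unset Strict Implicit.
Unset Printing Implicit Defensive.
Import Order.TTheory GRing.Theory Num.Theory.
Import numFieldNormedType.Exports.
Local Open Scope classical_set_scope.
Local Open Scope ring_scope.

(* A random vector in R^k is a family of k real random variables, and equality
   in distribution is equality of the joint distribution functions, whence the
   two possibly different underlying probability spaces. *)
Definition joint_cdf (R : realType) d (T : measurableType d)
    (P : probability T R) (k : nat) (X : 'I_k -> T -> R) (x : 'cV[R]_k) : \bar R :=
  P [set t | forall i, X i t <= x i 0].

Definition eq_in_dist (R : realType)
    d (T : measurableType d) (P : probability T R)
    d' (T' : measurableType d') (P' : probability T' R)
    (k : nat) (X : 'I_k -> T -> R) (Y : 'I_k -> T' -> R) : Prop :=
  forall x : 'cV[R]_k, joint_cdf P X x = joint_cdf P' Y x.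

Definition mulmx_vec (R : realType) (T : Type) (k : nat) (B : 'M[R]_k)
    (U : 'I_k -> T -> R) : 'I_k -> T -> R :=
  fun i t => (B *m \col_j U j t) i 0.

(* The uniform distribution on the unit sphere is the rotation invariant
   probability distribution carried by the sphere. *)
Definition uniform_on_sphere (R : realType) d (T : measurableType d)
    (P : probability T R) (k : nat) (U : 'I_k -> {RV P >-> R}) : Prop :=
  {ae P, forall t, \sum_(i < k) U i t ^+ 2 = 1} /\
  forall O : 'M[R]_k, O^T *m O = 1%:M ->
    eq_in_dist P P (mulmx_vec O (fun i t => U i t)) (fun i t => U i t).

(* C ranges over the sigma-algebra generated by the random vector U. *)
Definition independent_of_vector (R : realType) d (T : measurableType d)
    (P : probability T R) (k : nat) (Z : {RV P >-> R})
    (U : 'I_k -> {RV P >-> R}) : Prop :=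
  forall (B : set R) (C : set T), measurable B ->
    <<s [set U i @^-1` D | i in [set: 'I_k] & D in (@measurable _ R)] >> C ->
    P ((Z @^-1` B) `&` C) = (P (Z @^-1` B) * P C)%E.

Definition cdfR (R : realType) d (T : measurableType d)
    (P : probability T R) (Z : {RV P >-> R}) (r : R) : R := fine (cdf Z r).

Definition first_index (k : nat) (hk : (2 <= k)%N) : 'I_k := Ordinal (ltnW hk).

(* Q is the common distribution function of the components X_i. *)
Definition S_tilde (R : realType) d (T : measurableType d)
    (P : probability T R) (k : nat) (X : 'I_k -> {RV P >-> R}) (Q : R -> R)
    (I : {set 'I_k}) (u : R) (x : 'cV[R]_k) : R :=
  fine (P [set t | forall i, i \in I -> 1 - x i 0 / u < Q (X i t)]).

(* Submatrices and subvectors are indexed by ordinals below the cardinal of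
   the index set; the ordinal a stands for the index [enum_val a]. *)
Definition submx_set (R : Type) (k : nat) (S : 'M[R]_k) (J L : {set 'I_k}) :
    'M[R]_(#|J|, #|L|) :=
  mxsub (fun a : 'I_#|J| => enum_val a) (fun b : 'I_#|L| => enum_val b) S.

Definition subvec_set (R : Type) (k : nat) (y : 'cV[R]_k) (J : {set 'I_k}) :
    'cV[R]_#|J| :=
  rowsub (fun a : 'I_#|J| => enum_val a) y.

Definition ones (R : nzRingType) (n : nat) : 'cV[R]_n := const_mx 1.

Definition qform (R : realType) (k : nat) (S : 'M[R]_k) (I : {set 'I_k})
    (y : 'cV[R]_k) : R :=
  ((subvec_set y I)^T *m invmx (submx_set S I I) *m subvec_set y I) 0 0.

Definition qp_feasible (R : realType) (k : nat) (I : {set 'I_k}) :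
    set 'cV[R]_k :=
  [set y | forall i, i \in I -> 1 <= y i 0].

Definition qp_min (R : realType) (k : nat) (S : 'M[R]_k) (I : {set 'I_k}) : R :=
  inf [set qform S I y | y in @qp_feasible R k I].

Definition inv_ones (R : realType) (k : nat) (S : 'M[R]_k) (K : {set 'I_k}) :
    'cV[R]_#|K| :=
  invmx (submx_set S K K) *m ones R #|K|.

(* These are the optimality conditions of the quadratic programme, whose
   minimiser is 1 on K and S_MK S_KK^{-1} 1_K on M.  Positivity of
   S_KK^{-1} 1_K alone does not determine K: any singleton has it. *)
Definition qp_active_set (R : realType) (k : nat) (S : 'M[R]_k)
    (I K : {set 'I_k}) : Prop :=
  let M := I :\: K in
  [/\ K \subset I, (0 < #|K|)%N,
      (forall a : 'I_#|K|, 0 < inv_ones S K a 0) &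
      M != finset.set0 ->
      forall b : 'I_#|M|, 0 <= (submx_set S M K *m inv_ones S K - ones R #|M|) b 0].

(* The exponent of alpha is theta / 2 - 1 because w varies with index theta - 1
   and is evaluated at multiples of the square root of alpha, the Mahalanobis
   norm of the minimiser.  For Gaussian X, where w u = u and theta = 2, the
   exponents add up to alpha. *)
Definition gamma_exp (R : realType) (k : nat) (S : 'M[R]_k)
    (I K : {set 'I_k}) (theta : R) (a : 'I_#|K|) : R :=
  qp_min S I `^ (theta / 2 - 1) * inv_ones S K a 0.

Definition eta_index (R : realType) (k : nat) (S : 'M[R]_k)
    (I : {set 'I_k}) (theta : R) : R :=
  qp_min S I `^ (- (theta / 2)).

Definition regularly_varying (R : realType) (g : R -> R) (gamma : R) : Prop :=
  (forall u, 0 < u -> 0 < g u) /\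
  forall c : R, 0 < c -> g (c * u) / g u @[u --> +oo] --> c `^ gamma.

(* Main.v *)
(* Write a_i for the i-th column of A, so that X_i = R (a_i . U), and let c solve
   the dual of the quadratic programme: its support is K, and z = A c is the
   point of least norm in {z : a_i . z >= 1 for i in I}, with |z|^2 = alpha.  Put
   e = z / |z|.

   No density of U is needed.  To compare P(X_i > t + s_i / w(t), i in I) with
   P(X_i > t, i in I), rotate U by an angle of order h = 1 / (t w(t)) in the plane
   of e and a suitable vector xi orthogonal to e.  For directions u near e the
   rotation absorbs the individual shifts s_i up to o(h) and leaves the common
   shift rho = (sum_i c_i s_i) / alpha, so by rotation invariance only the radial
   tail at t (1 + rho h) / (a_i . u) has to be compared with that at t / (a_i . u).
   Directions away from e are negligible because the tail of R is rapidly
   varying.  The comparison has to be uniform for t / (a_i . u) between t |z| and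
   (1 + small) t |z|, which is a uniform convergence theorem for the regularly
   varying function w; as w need not be measurable, it is proved for the sets of
   points where the monotone tail of R drops by a factor e over about 1 / w.

   Applied to a single component this shows that the marginal tail is in the
   Gumbel domain with the same w, so that Q(X_i) > 1 - x_i / u means
   X_i > b - (ln x_i + o(1)) / w(b) with b the (1 - 1/u)-quantile, and the theorem
   follows. *)
Require Import Defs.
From mathcomp Require Import measurable_realfun ring lra.
Import Order.TTheory GRing.Theory Num.Theory.
Import numFieldNormedType.Exports.
Set Implicit Arguments.
Unset Strict Implicit.
Unset Printing Implicit Defensive.
Local Open Scope classical_set_scope.
Local Open Scope ring_scope.

(** * Tails in the Gumbel domain of attraction *)

(** For a fixed direction u, the orthant event with a common threshold t is the radial event R > t /
    g, where g is the smallest a_i . u over I. On the unit sphere g is at most 1 / |z|, a value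
    attained at e, so only the tail at l t with l slightly above |z| matters. A shift rho / w(t) of
    the threshold becomes l rho / w(t) in the radius, and w(l t) / w(t) is close to |z|^(theta - 1);
    the two factors together give exp(- rho |z|^theta) = exp(- rho alpha^(theta/2)). With s_i = - ln
    x_i this is the product of the powers of x_i with exponents alpha^(theta/2 - 1) c_i. The indices
    of I outside K need no separate treatment: the rotation absorbs their shifts as well, and they
    drop out of rho because their weight c_i is zero. Regular variation is the case of constant x,
    since replacing u by a u amounts to dividing every x_i by a. *)

Lemma near_pinfty_mull (R : realType) (P : set R) (c : R) : 0 < c ->
  (\forall x \near +oo, P x) -> \forall x \near +oo, P (c * x).
Proof.
move=> c0 [M [Mr MP]]; exists (M / c); split; first exact: num_real.
by move=> x; rewrite ltr_pdivrMr// mulrC => /MP.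
Qed.

Lemma lebesgue_measureD (R : realType) (c : R) (A : set R) : measurable A ->
  lebesgue_measure ((fun x => x + c) @^-1` A) = lebesgue_measure A.
Proof.
move=> mA; have mf : measurable_fun [set: R] (fun x : R => x + c).
  exact: measurable_funD.
pose nu := pushforward (@lebesgue_measure R)
  ((fun x => x + c) : measurableTypeR R -> measurableTypeR R).
rewrite [RHS](_ : _ = nu A)//.
apply: (lebesgue_measure_unique (mu := nu)) => //= _ [[a b]] _ <- /=.
transitivity (lebesgue_measure `]a - c, b - c]%classic); last first.
  congr lebesgue_measure; apply/seteqP; split => x /=;
  by rewrite !in_itv/= ltrBlDr lerBrDr.
rewrite !lebesgue_measure_itv/= !lte_fin ltrD2r.
by case: ifP => // _; rewrite -!EFinB; congr EFin; ring.
Qed.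

Section gumbel_tail.
Context {R : realType} (G w : R -> R) (theta : R).
Hypothesis G_gt0 : forall x : R, 0 < G x.
Hypothesis G_noninc : nonincreasing_fun G.
Hypothesis G_neg : forall x : R, x < 0 -> G x = 1.
Hypothesis G_cvg0 : G x @[x --> +oo] --> 0.
Hypothesis w_gt0 : forall u : R, 0 < u -> 0 < w u.
Hypothesis G_gumbel : forall x,
  G (u + x / w u) / G u @[u --> +oo] --> expR (- x).
Hypothesis w_rv : forall c : R, 0 < c ->
  w (c * u) / w u @[u --> +oo] --> c `^ (theta - 1).

Lemma gumbel_near_lt x y : expR (- x) < y ->
  \forall u \near +oo, G (u + x / w u) < y * G u.
Proof.
move=> xy; apply: filterS (cvgr_lt _ (@G_gumbel x) _ xy) => u.
by rewrite ltr_pdivrMr.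
Qed.

Lemma gumbel_near_gt x y : y < expR (- x) ->
  \forall u \near +oo, y * G u < G (u + x / w u).
Proof.
move=> xy; apply: filterS (cvgr_gt _ (@G_gumbel x) _ xy) => u.
by rewrite ltr_pdivlMr.
Qed.

(* If t w(t) <= C, then t - 2C / w(t) < 0, where the tail is 1, while the tail at
   such t tends to 0. *)
Lemma scaling_cvg_pinfty : u * w u @[u --> +oo] --> +oo.
Proof.
apply/cvgryPge => C0; pose C := Num.max C0 1.
have C1 : 1 <= C by rewrite /C le_max lexx orbT.
suff : \forall u \near +oo, C <= u * w u.
  by apply: filterS => u; apply: le_trans; rewrite /C le_max lexx.
have L : 0 < expR (2 * C) + 1 by rewrite addr_gt0// expR_gt0.
have h1 : \forall u \near +oo, G (u + (- (2 * C)) / w u) < (expR (2 * C) + 1) * G u.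
  by apply: gumbel_near_lt; rewrite opprK ltrDl.
have h2 : \forall u \near +oo, G u < (expR (2 * C) + 1)^-1.
  by apply: (cvgr_lt _ G_cvg0); rewrite invr_gt0.
near=> u.
have u0 : 0 < u by near: u; exact: nbhs_pinfty_gt.
have wu := w_gt0 u0.
rewrite leNgt; apply/negP => uC.
have : G (u + (- (2 * C)) / w u) < (expR (2 * C) + 1) * G u by near: u.
rewrite G_neg; last first.
  by rewrite mulNr subr_lt0 ltr_pdivlMr//; lra.
apply/negP; rewrite -leNgt mulrC -ler_pdivlMr// div1r; apply/ltW.
by near: u.
Unshelve. all: by end_near. Qed.

(* [h] is the step over which the tail drops from [q] by a factor [e], up to a
   relative error [d]; unlike [w] itself, the set of such [q] is measurable. *)
Definition is_efold (d q h : R) :=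
  (G (q + h * (1 + d)) < expR (-1) * G q) &&
  (expR (-1) * G q < G (q + h * (1 - d))).

Lemma is_efold_lt d q h h' : is_efold d q h -> is_efold d q h' ->
  h' * (1 - d) < h * (1 + d).
Proof.
move=> /andP[h1 _] /andP[_ h2]; rewrite ltNge; apply/negP => hh.
have := lt_trans h1 h2; apply/negP; rewrite -leNgt.
by apply: G_noninc; rewrite lerD2l.
Qed.

(** Measured in units of 1 / w(c t), the step 1 / w(t) tends to c^(theta - 1) = L, and the two
    bounds place 1 strictly between (1 - d) L and (1 + d) L. The points [x2] and [x1] leave room on
    either side for the two limits. *)
Lemma is_efold_near d c : 0 < c -> 0 < d < 1 ->
  (1 - d) * c `^ (theta - 1) < 1 -> 1 < (1 + d) * c `^ (theta - 1) ->
  \forall t \near +oo, is_efold d (c * t) (w t)^-1.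
Proof.
move=> c0 /andP[d0 d1] lo hi.
set L := c `^ (theta - 1) in lo hi *.
pose x1 := (1 + (1 + d) * L) / 2; pose x2 := ((1 - d) * L + 1) / 2.
have x11 : 1 < x1 < (1 + d) * L by rewrite /x1; lra.
have x21 : (1 - d) * L < x2 < 1 by rewrite /x2; lra.
case/andP: x11 => x11 x12; case/andP: x21 => x21 x22.
have e1 := @gumbel_near_lt x1 (expR (-1)).
have e2 := @gumbel_near_gt x2 (expR (-1)).
rewrite !ltr_expR !ltrN2 in e1 e2.
have := w_rv c0; rewrite -/L => wc.
have d'0 : 0 < 1 - d by lra.
have d''0 : 0 < 1 + d by lra.
near=> t.
have t0 : 0 < t by near: t; exact: nbhs_pinfty_gt.
have wt := w_gt0 t0.
have ct0 : 0 < c * t by rewrite mulr_gt0.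
have wct := w_gt0 ct0.
have r1 : x1 / (1 + d) < w (c * t) / w t.
  by near: t; apply: (cvgr_gt _ wc); rewrite ltr_pdivrMr// mulrC.
have r2 : w (c * t) / w t < x2 / (1 - d).
  by near: t; apply: (cvgr_lt _ wc); rewrite ltr_pdivlMr// mulrC.
apply/andP; split.
  apply: (@le_lt_trans _ _ (G (c * t + x1 / w (c * t)))); last first.
    near: t; apply: (near_pinfty_mull
      (P := fun q => G (q + x1 / w q) < expR (-1) * G q)) => //; exact: e1.
  apply: G_noninc; rewrite lerD2l ler_pdivrMr//.
  rewrite -mulrA (mulrC (1 + d)) mulrA (mulrC _ (w _)).
  by apply/ltW; rewrite -ltr_pdivrMr.
apply: (@lt_le_trans _ _ (G (c * t + x2 / w (c * t)))).
  near: t; apply: (near_pinfty_mull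
    (P := fun q => expR (-1) * G q < G (q + x2 / w q))) => //; exact: e2.
apply: G_noninc; rewrite lerD2l ler_pdivlMr//.
rewrite -mulrA (mulrC (1 - d)) mulrA (mulrC _ (w _)).
by apply/ltW; rewrite -ltr_pdivlMr.
Unshelve. all: by end_near. Qed.

Let mG : measurable_fun [set: R] G.
Proof. exact: nonincreasing_measurable. Qed.

Lemma measurable_is_efold d (t h : R) :
  measurable [set x | is_efold d (expR x * t) h].
Proof.
rewrite [X in measurable X](_ : _ =
  (fun x => is_efold d (expR x * t) h) @^-1` [set true])//.
rewrite -[X in measurable X]setTI.
have mq : measurable_fun [set: R] (fun x : R => expR x * t).
  by apply: measurable_funM => //; exact: measurable_expR.
suff : measurable_fun [set: R] (fun x => is_efold d (expR x * t) h).
  by apply => //.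
apply: measurable_and; apply: measurable_fun_ltr.
- by apply: measurableT_comp => //; apply: measurable_funD.
- by apply: measurable_funM => //; exact: measurableT_comp.
- by apply: measurable_funM => //; exact: measurableT_comp.
- by apply: measurableT_comp => //; apply: measurable_funD.
Qed.

(** On the logarithmic scale a dilation becomes a translation, under which Lebesgue measure is
    invariant. Asking for all [m >= N] makes the sets increase with [N]. *)
Definition efold_from d k (t : R ^nat) (N : nat) : set R :=
  `[0, k]%classic `&`
  \bigcap_(m in [set m | (N <= m)%N]) [set x | is_efold d (expR x * t m) (w (t m))^-1].

Lemma measurable_efold_from d k t N : measurable (efold_from d k t N).
Proof.
apply: measurableI => //; apply: bigcap_measurableType => m _.
exact: measurable_is_efold.
Qed.

(** Every point of [0, k] is eventually good, so continuity from below applies. The bound on [k]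
    keeps exp(x (theta - 1)) within a factor 1 + d of 1; the summand 1 in it allows theta = 1 when
    [k] is later obtained by division. *)
Lemma efold_from_measure d k (t : R ^nat) : 0 < d < 1 -> 0 < k ->
  k * (`|theta - 1| + 1) < ln (1 + d) -> t n @[n --> \oo] --> +oo ->
  \forall N \near \oo, ((3 / 4 * k)%:E < lebesgue_measure (efold_from d k t N))%E.
Proof.
move=> d01 k0 kd ty; case/andP: (d01) => d0 d1.
have ev x : 0 <= x <= k -> \forall t \near +oo, is_efold d (expR x * t) (w t)^-1.
  move=> /andP[x0 xk]; have E0 := expR_gt0 x.
  have z1 : `|x * (theta - 1)| < ln (1 + d).
    apply: le_lt_trans kd; rewrite normrM ger0_norm//.
    by apply: ler_pM => //; rewrite lerDl.
  have d'0 : 0 < 1 + d by lra.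
  have pE : expR x `^ (theta - 1) = expR (x * (theta - 1)).
    by rewrite expRM.
  move: z1; rewrite ltr_norml => /andP[z1 z2].
  have h1 : expR (x * (theta - 1)) < 1 + d by rewrite -[ltRHS]lnK ?posrE// ltr_expR.
  have h2 : (1 + d)^-1 < expR (x * (theta - 1)).
    by rewrite -[ltLHS]lnK ?posrE ?invr_gt0// ltr_expR lnV ?posrE.
  apply: is_efold_near => //; rewrite pE.
    rewrite mulrC -ltr_pdivlMr ?div1r; last lra.
    apply: (lt_trans h1); rewrite -div1r ltr_pdivlMr; last lra.
    by have := mulr_gt0 d0 d0; lra.
  by rewrite mulrC -ltr_pdivrMr// div1r.
have U : \bigcup_N efold_from d k t N = `[0, k]%classic.
  apply/seteqP; split => [x [N _ []]//|x xk].
  have xk' : 0 <= x <= k by move: xk; rewrite /= in_itv.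
  have [N _ HN] := ty _ (ev x xk').
  by exists N => //; split => // m Nm; exact: HN.
have C : lebesgue_measure (efold_from d k t N) @[N --> \oo] --> k%:E.
  have -> : k%:E = lebesgue_measure (\bigcup_N efold_from d k t N).
    by rewrite U lebesgue_measure_itv/= lte_fin k0 -EFinB subr0.
  apply: nondecreasing_cvg_mu => //.
  - by move=> i; exact: measurable_efold_from.
  - by apply: bigcupT_measurable => i; exact: measurable_efold_from.
  - move=> n m nm; apply/subsetPset => x [xk Hx]; split => // j /= mj.
    by apply: Hx => /=; exact: leq_trans mj.
have /fine_cvgP[Cf Cr] := C.
have K : 3 / 4 * k < k by lra.
near=> N.
have Nf : lebesgue_measure (efold_from d k t N) \is a fin_num by near: N.
rewrite -(fineK Nf) lte_fin; near: N; exact: (cvgr_gt _ Cr).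
Unshelve. all: by end_near. Qed.

(* The good sets of [t] and of [e^y t] fill more than 3/4 of [0, k] and differ by
   the small translation [y]; hence some point is seen from both, and the e-folding
   steps 1 / w at the two places are compared with the one at that point. *)
Lemma scaling_rv_seq d (t y : R ^nat) : 0 < d < 1 ->
  t n @[n --> \oo] --> +oo -> y n @[n --> \oo] --> 0 ->
  \forall n \near \oo,
    (w (t n))^-1 * (1 - d) < (w (expR (y n) * t n))^-1 * (1 + d) /\
    (w (expR (y n) * t n))^-1 * (1 - d) < (w (t n))^-1 * (1 + d).
Proof.
move=> d01 ty y0; case/andP: (d01) => d0 d1.
have D : 0 < `|theta - 1| + 1 by rewrite ltr_wpDl.
pose k := ln (1 + d) / 2 / (`|theta - 1| + 1).
have l0 : 0 < ln (1 + d) by rewrite ln_gt0//; lra.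
have k0 : 0 < k by rewrite !divr_gt0.
have kd : k * (`|theta - 1| + 1) < ln (1 + d) by rewrite divfK ?gt_eqF//; lra.
pose r n := expR (y n) * t n.
have ry : r n @[n --> \oo] --> +oo.
  apply/cvgryPge => M.
  near=> n.
  have yn : - ln 2 < y n by near: n; apply: (cvgr_gt _ y0); rewrite oppr_lt0 ln_gt0//; lra.
  have tn : Num.max 0 (2 * M) <= t n by near: n; exact: (cvgryPge _).1 ty _.
  have e2 : 2^-1 < expR (y n).
    by rewrite -[ltLHS]lnK ?posrE ?invr_gt0// ltr_expR lnV ?posrE.
  move: tn; rewrite ge_max => /andP[tn tM].
  apply: (@le_trans _ _ (2^-1 * t n)); first lra.
  by apply: ler_wpM2r => //; exact: ltW.
have mV := efold_from_measure d01 k0 kd ty.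
have mW := efold_from_measure d01 k0 kd ry.
have [N [yN VN WN]] : exists N, [/\ (forall n, (N <= n)%N -> `|y n| < k / 4),
   ((3 / 4 * k)%:E < lebesgue_measure (efold_from d k t N))%E &
   ((3 / 4 * k)%:E < lebesgue_measure (efold_from d k r N))%E].
  have : \forall n \near \oo, `|y n| < k / 4.
    have k4 : 0 < k / 4 by rewrite divr_gt0.
    exact: (cvgr0_norm_lt _ y0 _ k4).
  case=> N1 _ HN1; case: mV => N2 _ HN2; case: mW => N3 _ HN3.
  exists (maxn N1 (maxn N2 N3)); split.
  - by move=> n; rewrite geq_max => /andP[? _]; exact: HN1.
  - by apply: HN2; rewrite /= !leq_max leqnn orbT.
  - by apply: HN3; rewrite /= !leq_max leqnn !orbT.
exists N => // n /= Nn.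
have [x Vx Wx] : exists2 x, efold_from d k t N x & efold_from d k r N (x - y n).
  apply: contrapT => no.
  pose V := efold_from d k t N; pose W := (fun x => x - y n) @^-1` efold_from d k r N.
  have mV' : measurable V by exact: measurable_efold_from.
  have mW' : measurable W.
    rewrite -[W]setTI.
    by apply: (_ : measurable_fun [set: R] (fun x : R => x - y n)) => //;
      [exact: measurable_funB|exact: measurable_efold_from].
  have VW0 : V `&` W = set0.
    by rewrite -subset0 => x [Vx Wx]; apply: no; exists x.
  have WE : lebesgue_measure W = lebesgue_measure (efold_from d k r N).
    by apply: (@lebesgue_measureD _ (- y n)); exact: measurable_efold_from.
  (* This interval has length 3/2 k, too short for two disjoint sets of measure above 3/4 k each;
     this dictates the bound k / 4 on the translation. *)
  have sub : V `|` W `<=` `[- (k / 4), 5 / 4 * k]%classic.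
    have := yN _ Nn; rewrite ltr_norml => /andP[y1 y2].
    by move=> x [] [] /=; rewrite !in_itv/= => /andP[x1 x2] _; apply/andP; split; lra.
  have : (lebesgue_measure (V `|` W) <= (3 / 2 * k)%:E)%E.
    apply: (@le_trans _ _ (lebesgue_measure `[- (k / 4), 5 / 4 * k]%classic)).
      by apply: le_measure; rewrite ?inE//; exact: measurableU.
    rewrite lebesgue_measure_itv/= lte_fin ifT; last lra.
    by rewrite -EFinB lee_fin; lra.
  have -> : lebesgue_measure (V `|` W) =
      (lebesgue_measure V + lebesgue_measure (efold_from d k r N))%E.
    by rewrite -WE; exact: measureU.
  apply/negP; rewrite -ltNge.
  have -> : (3 / 2 * k)%:E = ((3 / 4 * k)%:E + (3 / 4 * k)%:E)%E.
    by rewrite -EFinD; congr EFin; lra.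
  exact: lteD.
have e1 : is_efold d (expR x * t n) (w (t n))^-1 by apply: (Vx.2).
have e2 : is_efold d (expR x * t n) (w (r n))^-1.
  have := (Wx.2 n Nn); rewrite /= /r mulrA -expRD subrK.
  by [].
split; [exact: (is_efold_lt e2 e1)|exact: (is_efold_lt e1 e2)].
Unshelve. all: by end_near. Qed.
Lemma scaling_rv_seq_cvg (t y : R ^nat) :
  t n @[n --> \oo] --> +oo -> y n @[n --> \oo] --> 0 ->
  w (expR (y n) * t n) / w (t n) @[n --> \oo] --> (1 : R).
Proof.
move=> ty y0; apply/cvgrPdist_lt => e e0.
(* The ratio lies between (1 - d) / (1 + d) and (1 + d) / (1 - d), hence within 4 d < e of 1 because
   d <= 1/2. *)
pose d := Num.min (1/2) (e / 5).
have d0 : 0 < d by rewrite lt_min; apply/andP; split; lra.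
have d2 : d <= 1 / 2 by rewrite /d ge_min lexx.
have de : d <= e / 5 by rewrite /d ge_min lexx orbT.
have d01 : 0 < d < 1 by apply/andP; split; lra.
near=> n.
have tn : 0 < t n by near: n; exact: (cvgryPgt _).1 ty _.
have wn := w_gt0 tn.
have rn : 0 < expR (y n) * t n by rewrite mulr_gt0// expR_gt0.
have wrn := w_gt0 rn.
have [h1 h2] : (w (t n))^-1 * (1 - d) < (w (expR (y n) * t n))^-1 * (1 + d) /\
    (w (expR (y n) * t n))^-1 * (1 - d) < (w (t n))^-1 * (1 + d).
  by near: n; exact: scaling_rv_seq.
set a := w (expR (y n) * t n) in wrn h1 h2 *; set b := w (t n) in wn h1 h2 *.
have {}h1 : a * (1 - d) < b * (1 + d).
  move: h1; rewrite -(ltr_pM2l (mulr_gt0 wrn wn)).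
  have -> : a * b * (b^-1 * (1 - d)) = a * (1 - d) by field; rewrite gt_eqF.
  by have -> : a * b * (a^-1 * (1 + d)) = b * (1 + d) by field; rewrite gt_eqF.
have {}h2 : b * (1 - d) < a * (1 + d).
  move: h2; rewrite -(ltr_pM2l (mulr_gt0 wrn wn)).
  have -> : a * b * (a^-1 * (1 - d)) = b * (1 - d) by field; rewrite gt_eqF.
  by have -> : a * b * (b^-1 * (1 + d)) = a * (1 + d) by field; rewrite gt_eqF.
rewrite -[X in `|X - _|](@divff _ b) ?gt_eqF// -mulrBl normrM normfV (gtr0_norm wn).
rewrite ltr_pdivrMr// ltr_norml.
apply/andP; split; nra.
Unshelve. all: by end_near. Qed.

(** Monotonicity of [G] upgrades the pointwise limits at z - eta / 2 and z + eta / 2 to a bound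
    along any x n tending to z. *)
Lemma gumbel_seq (z eta : R) (q x : R ^nat) : 0 < eta ->
  q n @[n --> \oo] --> +oo -> x n @[n --> \oo] --> z ->
  \forall n \near \oo, expR (- (z + eta)) * G (q n) <= G (q n + x n / w (q n))
    <= expR (- (z - eta)) * G (q n).
Proof.
move=> eta0 qy xz.
have h1 : \forall n \near \oo,
    expR (- (z + eta)) * G (q n) < G (q n + (z + eta / 2) / w (q n)).
  have H : expR (- (z + eta)) < expR (- (z + eta / 2)) by rewrite ltr_expR; lra.
  exact: (qy _ (gumbel_near_gt H)).
have h2 : \forall n \near \oo,
    G (q n + (z - eta / 2) / w (q n)) < expR (- (z - eta)) * G (q n).
  have H : expR (- (z - eta / 2)) < expR (- (z - eta)) by rewrite ltr_expR; lra.
  exact: (qy _ (gumbel_near_lt H)).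
near=> n.
have qn : 0 < q n by near: n; exact: (cvgryPgt _).1 qy _.
have wq := w_gt0 qn.
have : `|z - x n| < eta / 2.
  by near: n; apply: (cvgrPdist_lt _ _).1 xz _ _; lra.
rewrite ltr_norml => /andP[a1 a2].
apply/andP; split.
- apply: (@le_trans _ _ (G (q n + (z + eta / 2) / w (q n)))).
    by apply/ltW; near: n.
  by apply: G_noninc; rewrite lerD2l ler_wpM2r ?invr_ge0//; lra.
- apply: (@le_trans _ _ (G (q n + (z - eta / 2) / w (q n)))); last first.
    by apply/ltW; near: n.
  by apply: G_noninc; rewrite lerD2l ler_wpM2r ?invr_ge0//; lra.
Unshelve. all: by end_near. Qed.

(** In units of 1 / w(l t) the shift l rho / w(t) is rho l w(l t) / w(t). Its limit is rho l0^theta: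
    one factor l0 comes from l, the factor l0^(theta - 1) from [w]. The ratio of [w] is split at l0
    t, because [w_rv] handles the fixed factor l0 and [scaling_rv_seq_cvg] the factor l / l0 =
    exp(y) that tends to 1. *)
Lemma tail_shift_seq (rho eta l0 : R) (t l : R ^nat) : 0 < eta -> 0 < l0 ->
  t n @[n --> \oo] --> +oo -> l n @[n --> \oo] --> l0 ->
  \forall n \near \oo,
    expR (- (rho * l0 `^ theta + eta)) * G (l n * t n) <=
      G (l n * (t n + rho / w (t n))) <=
    expR (- (rho * l0 `^ theta - eta)) * G (l n * t n).
Proof.
move=> eta0 l00 ty ll.
pose y n := ln (l n / l0).
have lpos : \forall n \near \oo, l0 / 2 < l n by apply: (cvgr_gt _ ll); lra.
have lE : \forall n \near \oo, l n = expR (y n) * l0.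
  apply: filterS lpos => n ln0.
  by rewrite lnK ?divfK ?gt_eqF// posrE divr_gt0//; lra.
have y0 : y n @[n --> \oo] --> 0.
  have c1 : l n / l0 @[n --> \oo] --> (1 : R).
    by rewrite -(@divff _ l0) ?gt_eqF//; apply: cvgM => //; exact: cvg_cst.
  have c2 : ln x @[x --> (1 : R)] --> ln (1 : R) by exact: continuous_ln.
  by rewrite -(ln1 R); exact: (cvg_comp _ _ c1 c2).
have l0t : l0 * t n @[n --> \oo] --> +oo.
  by move=> P nP; exact: (ty _ (near_pinfty_mull l00 nP)).
have qy : l n * t n @[n --> \oo] --> +oo.
  apply/cvgryPge => M; near=> n.
  have ln : l0 / 2 < l n by near: n.
  have tn : Num.max 0 (2 * M) <= l0 * t n by near: n; exact: (cvgryPge _).1 l0t _.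
  move: tn; rewrite ge_max => /andP[tn tM].
  have t0 : 0 <= t n by rewrite -(pmulr_rge0 _ l00).
  nra.
have xz : rho * l n * (w (l n * t n) / w (t n)) @[n --> \oo] --> rho * l0 `^ theta.
  have -> : rho * l0 `^ theta = rho * l0 * (1 * l0 `^ (theta - 1)).
    have {1}-> : theta = 1 + (theta - 1) by ring.
    rewrite [X in rho * X = _]powRD; last by rewrite (gt_eqF l00) implybT.
    by rewrite powRr1 ?ltW// mul1r mulrA.
  apply: cvgM; first by apply: cvgM => //; exact: cvg_cst.
  apply: (@cvg_trans _ ((w (expR (y n) * (l0 * t n)) / w (l0 * t n) *
      (w (l0 * t n) / w (t n))) @[n --> \oo])); last first.
    by apply: cvgM; [exact: scaling_rv_seq_cvg|exact: (cvg_comp _ _ ty (w_rv l00))].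
  apply: near_eq_cvg; near=> n.
  have tn : 0 < t n by near: n; exact: (cvgryPgt _).1 ty _.
  have E : l n = expR (y n) * l0 by near: n.
  rewrite [expR (y n) * _]mulrA -E [LHS]mulrA divfK// gt_eqF//.
  by apply: w_gt0; rewrite mulr_gt0.
near=> n.
have tn : 0 < t n by near: n; exact: (cvgryPgt _).1 ty _.
have ln : 0 < l n.
  have : l0 / 2 < l n by near: n.
  by apply: lt_trans; rewrite divr_gt0.
have -> : l n * (t n + rho / w (t n)) =
    l n * t n + rho * l n * (w (l n * t n) / w (t n)) / w (l n * t n).
  have wn := w_gt0 tn; have wl : 0 < w (l n * t n) by rewrite w_gt0 ?mulr_gt0.
  by field; rewrite !gt_eqF.
by near: n; exact: gumbel_seq.
Unshelve. all: by end_near. Qed.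

(** If no [d] worked, counterexamples with t > n and l within 1 / (n + 1) of l0 would form sequences
    contradicting [tail_shift_seq]. The interval is one-sided since it is applied at the least
    possible value of l. *)
Lemma tail_shift_unif (rho eta l0 : R) : 0 < eta -> 0 < l0 ->
  exists2 d, 0 < d & \forall t \near +oo, forall l, l0 <= l <= l0 + d ->
    expR (- (rho * l0 `^ theta + eta)) * G (l * t) <=
      G (l * (t + rho / w t)) <=
    expR (- (rho * l0 `^ theta - eta)) * G (l * t).
Proof.
move=> eta0 l00; apply: contrapT => no.
pose ok (p : R * R) := expR (- (rho * l0 `^ theta + eta)) * G (p.2 * p.1) <=
      G (p.2 * (p.1 + rho / w p.1)) <=
    expR (- (rho * l0 `^ theta - eta)) * G (p.2 * p.1).
have /choice[p Hp] : forall n : nat, exists p : R * R,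
    [/\ n%:R < p.1, l0 <= p.2 <= l0 + n.+1%:R^-1 & ~ ok p].
  move=> n; apply: contrapT => no2; apply: no.
  exists (n.+1%:R^-1); first by rewrite invr_gt0.
  exists n%:R; split; first exact: num_real.
  move=> t nt l ll; apply: contrapT => no3.
  by apply: no2; exists (t, l).
have ty : (p n).1 @[n --> \oo] --> +oo.
  apply/cvgryPgt => A; near=> n; apply: (@lt_trans _ _ n%:R).
    by near: n; exact: (cvgryPgt _).1 (@cvgr_idn R) A.
  by have [] := Hp n.
have ll : (p n).2 @[n --> \oo] --> l0.
  apply: (@squeeze_cvgr _ _ _ _ (fun=> l0) (fun n => l0 + n.+1%:R^-1)).
  - by near=> n; have [] := Hp n.
  - exact: cvg_cst.
  - rewrite -[X in _ --> X]addr0; apply: cvgD; first exact: cvg_cst.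
    exact: cvg_harmonic.
have [N _ HN] := tail_shift_seq rho eta0 l00 ty ll.
by have [_ _] := Hp N; apply; exact: (HN N (leqnn N)).
Unshelve. all: by end_near. Qed.

(** As u w(u) tends to infinity, the distance (b - a) t eventually exceeds any fixed number of units
    1 / w(a t); - ln(C / 2) such units reduce the tail to about C / 2 of its value. *)
Lemma tail_rapid (a b C : R) : 0 < a -> a < b -> 0 < C ->
  \forall t \near +oo, G (b * t) <= C * G (a * t).
Proof.
move=> a0 ab C0.
have h1 := @gumbel_near_lt (- ln (C / 2)) C.
have l2 : expR (- (- ln (C / 2))) < C by rewrite opprK lnK ?posrE; lra.
have {h1}h1 := near_pinfty_mull a0 (h1 l2).
near=> t.
have t0 : 0 < t by near: t; exact: nbhs_pinfty_gt.
have at0 : 0 < a * t by rewrite mulr_gt0.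
have wat := w_gt0 at0.
apply: (@le_trans _ _ (G (a * t + (- ln (C / 2)) / w (a * t)))); last first.
  by apply/ltW; near: t.
apply: G_noninc.
have : - ln (C / 2) / ((b - a) / a) <= (a * t) * w (a * t).
  near: t; apply: (near_pinfty_mull (P := fun u => _ <= u * w u)) => //.
  exact: (cvgryPge _).1 scaling_cvg_pinfty _.
rewrite ler_pdivrMr ?divr_gt0 ?subr_gt0// => H.
have {}H : - ln (C / 2) / w (a * t) <= (b - a) * t.
  rewrite ler_pdivrMr//; apply: (le_trans H).
  by rewrite le_eqVlt; apply/orP; left; apply/eqP; field; rewrite gt_eqF.
lra.
Unshelve. all: by end_near. Qed.

End gumbel_tail.

(** * Joint laws *)

Definition rtuple (R : realType) (T : Type) (k : nat) (X : 'I_k -> T -> R) (t : T) :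
  k.-tuple R := [tuple X i t | i < k].

Definition tvec (R : realType) (k : nat) (v : k.-tuple R) : 'cV[R]_k :=
  \col_i tnth v i.

Lemma tvec_rtuple (R : realType) (T : Type) (k : nat) (X : 'I_k -> T -> R) t :
  tvec (rtuple X t) = \col_i X i t.
Proof. by apply/colP => i; rewrite !mxE tnth_mktuple. Qed.

Lemma measurable_rtuple (R : realType) d (T : measurableType d) (k : nat)
    (X : 'I_k -> T -> R) : (forall i, measurable_fun [set: T] (X i)) ->
  measurable_fun [set: T] (rtuple X).
Proof.
move=> mX; apply/measurable_fun_tnthP => i.
rewrite [X in measurable_fun _ X](_ : _ = X i)//.
by apply/funext => t /=; rewrite tnth_mktuple.
Qed.

Lemma measurable_mulmx_tvec (R : realType) (k : nat) (B : 'M[R]_k) (i : 'I_k) :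
  measurable_fun [set: k.-tuple R] (fun v => (B *m tvec v) i 0).
Proof.
rewrite [X in measurable_fun _ X](_ : _ = fun v => \sum_j B i j * tnth v j).
  by apply: measurable_sum => j; apply: measurable_funM => //; exact: measurable_tnth.
by apply/funext => v; rewrite mxE; apply: eq_bigr => j _; rewrite mxE.
Qed.

Section lower_orthants.
Context {R : realType} (k : nat).

Definition lower_orthant (x : 'cV[R]_k) : set (k.-tuple R) :=
  [set v | forall i, tnth v i <= x i 0].

Definition lower_orthants : set (set (k.-tuple R)) := range lower_orthant.

Lemma measurable_lower_orthant x : measurable (lower_orthant x).
Proof.
rewrite [X in measurable X](_ : _ =
    \bigcap_(i in [set: 'I_k]) ((@tnth _ R ^~ i) @^-1` `]-oo, x i 0]%classic)).
  apply: fin_bigcap_measurable => // i _.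
  by rewrite -[X in measurable X]setTI; exact: measurable_tnth.
apply/seteqP; split => v /= h i; last by have := h i I; rewrite /= in_itv.
by move=> _ /=; rewrite in_itv/=; exact: h.
Qed.

Lemma lower_orthants_setI : setI_closed lower_orthants.
Proof.
move=> _ _ [x _ <-] [y _ <-].
exists (\col_i Num.min (x i 0) (y i 0)) => //.
apply/seteqP; split => v /=.
  move=> h; split => i; have := h i; rewrite mxE le_min => /andP[] //.
by move=> [h1 h2] i; rewrite mxE le_min h1 h2.
Qed.

Lemma lower_orthants_cover : \bigcup_n lower_orthant (const_mx n%:R) = setT.
Proof.
rewrite -subTset => v _; exists (\sum_i Num.trunc `|tnth v i|).+1 => // i.
rewrite mxE; apply: (le_trans (ler_norm _)); apply: ltW.
apply: (lt_le_trans (truncnS_gt _)).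
by rewrite ler_nat ltnS (bigD1 i)//= leq_addr.
Qed.

Lemma lower_orthants_generate : measurable = <<s lower_orthants >>.
Proof.
apply/seteqP; split; last first.
  apply: smallest_sub; first exact: sigma_algebra_measurable.
  by move=> _ [x _ <-]; exact: measurable_lower_orthant.
have H (i : 'I_k) (r : R) : <<s lower_orthants >> [set v | tnth v i <= r].
  rewrite (_ : mkset _ = \bigcup_n lower_orthant (\col_j if j == i then r else n%:R)).
    apply: (@bigcupT_measurable _ (g_sigma_algebraType lower_orthants)) => n.
    by apply: sub_sigma_algebra; exists (\col_j if j == i then r else n%:R).
  apply/seteqP; split => v /=; last first.
    by case=> n _ /(_ i); rewrite mxE eqxx.
  move=> vr; have : [set: k.-tuple R] v by []; rewrite -lower_orthants_cover.
  case=> n _ hn; exists n => // j; rewrite mxE; case: eqP => [->//|_].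
  by have := hn j; rewrite mxE.
apply: smallest_sub; first exact: smallest_sigma_algebra.
rewrite -bigcup_seq; apply: bigcup_sub => i _.
move=> _ [B mB <-]; rewrite setTI.
have mt : @measurable_fun _ _ (g_sigma_algebraType lower_orthants) R setT (@tnth _ R ^~ i).
  apply: (measurability _ (RGenOInfty.measurableE R)) => _ [_ [r ->] <-].
  rewrite setTI (_ : _ @^-1` _ = ~` [set v | tnth v i <= r]).
    by apply: measurableC; exact: H.
  apply/seteqP; split => v /=; rewrite in_itv/= andbT.
    by move=> rv; apply/negP; rewrite -ltNge.
  by move/negP; rewrite -ltNge.
by have := mt measurableT B mB; rewrite setTI.
Qed.

End lower_orthants.

(** Lower orthants are stable under intersection, generate the Borel sets and exhaust the space
    along a sequence, so the joint distribution function determines the law. *)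
Lemma eq_in_dist_measure (R : realType) d (T : measurableType d) (P : probability T R)
    d' (T' : measurableType d') (P' : probability T' R) (k : nat)
    (X : 'I_k -> T -> R) (Y : 'I_k -> T' -> R) (B : set (k.-tuple R)) :
  (forall i, measurable_fun [set: T] (X i)) ->
  (forall i, measurable_fun [set: T'] (Y i)) ->
  eq_in_dist P P' X Y -> measurable B ->
  P (rtuple X @^-1` B) = P' (rtuple Y @^-1` B).
Proof.
move=> mX mY XY mB.
pose fX : {mfun T >-> k.-tuple R} := mfun_Sub (mem_set (measurable_rtuple mX)).
pose fY : {mfun T' >-> k.-tuple R} := mfun_Sub (mem_set (measurable_rtuple mY)).
suff : distribution P fX B = distribution P' fY B by [].
apply: (measure_unique (@lower_orthants R k) (fun n => lower_orthant (const_mx n%:R))) => //.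
- exact: lower_orthants_generate.
- exact: lower_orthants_setI.
- by move=> n; exists (const_mx n%:R).
- exact: lower_orthants_cover.
- move=> _ [x _ <-]; have := XY x; rewrite /joint_cdf.
  have E (S : Type) (Z : 'I_k -> S -> R) :
      rtuple Z @^-1` lower_orthant x = [set t | forall i, Z i t <= x i 0].
    by apply/seteqP; split => t /= h i; have := h i; rewrite tnth_mktuple.
  by rewrite -!E.
- by move=> n; rewrite -ge0_fin_numE//; exact: fin_num_measure (measurable_lower_orthant _).
Qed.

Lemma measurable_mulmx_vec (R : realType) d (T : measurableType d)
    (P : probability T R) (k : nat) (O : 'M[R]_k) (U : 'I_k -> {RV P >-> R}) i :
  measurable_fun [set: T] (mulmx_vec O (fun i t => U i t) i).
Proof.
rewrite (_ : mulmx_vec _ _ _ = (fun v => (O *m tvec v) i 0) \o rtuple (fun i t => U i t)).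
  by apply: measurableT_comp; [exact: measurable_mulmx_tvec|exact: measurable_rtuple].
by apply/funext => t; rewrite /= tvec_rtuple.
Qed.

Lemma uniform_rotation (R : realType) d (T : measurableType d)
    (P : probability T R) (k : nat) (U : 'I_k -> {RV P >-> R}) (O : 'M[R]_k)
    (B : set (k.-tuple R)) :
  uniform_on_sphere U -> O^T *m O = 1%:M -> measurable B ->
  P (rtuple (mulmx_vec O (fun i t => U i t)) @^-1` B) =
  P (rtuple (fun i t => U i t) @^-1` B).
Proof.
move=> [_ inv] OO mB; apply: eq_in_dist_measure (inv _ OO) mB => // i.
exact: measurable_mulmx_vec.
Qed.

Section independent_radius.
Context {R : realType} {k : nat} {d : measure_display} {T : measurableType d}
  {P : probability T R} (Z : {RV P >-> R}) (U : 'I_k -> {RV P >-> R}).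
Hypothesis ZU : independent_of_vector Z U.

Let rU := rtuple (fun i t => U i t).

(** The independence hypothesis speaks of the sigma-algebra generated by the coordinates; this makes
    it applicable to Borel events of the whole vector. *)
Lemma rtuple_preimage_gen (B : set (k.-tuple R)) : measurable B ->
  <<s [set U i @^-1` D | i in [set: 'I_k] & D in (@measurable _ R)] >> (rU @^-1` B).
Proof.
set gen := [set _ | _ in _ & _ in _] => mB.
have mU i : measurable_fun [set: g_sigma_algebraType gen] (U i : g_sigma_algebraType gen -> R).
  by move=> _ D mD; rewrite setTI; apply: sub_sigma_algebra; exists i => //; exists D.
have := measurable_rtuple mU measurableT mB.
by rewrite setTI.
Qed.

Lemma measurable_rU : measurable_fun [set: T] rU.
Proof. by apply: measurable_rtuple => i; exact: measurable_funPT. Qed.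

Let lawU : {mfun T >-> k.-tuple R} := mfun_Sub (mem_set measurable_rU).

(** [V] stands for [U] or a rotated [U]. Since events of [V] are events of [U], independence of [Z]
    carries over, and the law of the pair is the product measure by uniqueness on rectangles. *)
Lemma joint_law (V : T -> k.-tuple R) (S : set (k.-tuple R * R)) :
  measurable_fun [set: T] V ->
  (forall B, measurable B -> P (V @^-1` B) = P (rU @^-1` B)) ->
  (forall B, measurable B -> exists2 C, measurable C & V @^-1` B = rU @^-1` C) ->
  measurable S ->
  P [set t | S (V t, Z t)] =
    (\int[distribution P lawU]_u distribution P Z (xsection S u))%E.
Proof.
move=> mV VU VC mS.
have mVZ : measurable_fun [set: T] (fun t => (V t, Z t)) by exact: measurable_fun_pair.
pose VZ : {mfun T >-> (k.-tuple R * R)%type} := mfun_Sub (mem_set mVZ).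
transitivity (distribution P VZ S); first by [].
rewrite -(@product_measure_unique _ _ _ _ _ (distribution P lawU) (distribution P Z)
  (distribution P VZ))//.
move=> A B mA mB.
have [C mC CE] := VC _ mA.
transitivity (P ((Z @^-1` B) `&` (rU @^-1` C))); first by rewrite setIC -CE.
rewrite (ZU mB (rtuple_preimage_gen mC)) muleC; congr (_ * _)%E.
by rewrite -CE VU.
Qed.

Lemma joint_lawU (S : set (k.-tuple R * R)) : measurable S ->
  P [set t | S (rU t, Z t)] =
    (\int[distribution P lawU]_u distribution P Z (xsection S u))%E.
Proof.
by move=> mS; apply: joint_law => //; [exact: measurable_rU|move=> B mB; exists B].
Qed.

Lemma rotation_invariant (O : 'M[R]_k) (S : set (k.-tuple R * R)) :
  uniform_on_sphere U -> O^T *m O = 1%:M -> measurable S ->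
  P [set t | S (rtuple (mulmx_vec O (fun i t => U i t)) t, Z t)] =
  P [set t | S (rU t, Z t)].
Proof.
move=> unif OO mS; rewrite joint_lawU//.
have mf : measurable_fun [set: k.-tuple R] (rtuple (fun i v => (O *m tvec v) i 0)).
  by apply: measurable_rtuple => i; exact: measurable_mulmx_tvec.
have mO := measurable_mulmx_vec O U.
apply: joint_law => //.
- exact: measurable_rtuple.
- by move=> B mB; exact: uniform_rotation.
- move=> B mB; exists (rtuple (fun i v => (O *m tvec v) i 0) @^-1` B).
    by rewrite -[X in measurable X]setTI; exact: mf.
  rewrite -comp_preimage; congr (_ @^-1` B); apply: funext => t /=.
  by apply: eq_mktuple => i; rewrite tvec_rtuple.
Qed.

(** Conditioning on the direction: an inequality about the radius alone, valid for each fixed u, is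
    integrated over the law of [U]. *)
Lemma conditional_le (C : R) (S S' : set (k.-tuple R * R)) :
  0 <= C -> measurable S -> measurable S' ->
  (forall u, (P [set t | S (u, Z t)] <= C%:E * P [set t | S' (u, Z t)])%E) ->
  (P [set t | S (rU t, Z t)] <= C%:E * P [set t | S' (rU t, Z t)])%E.
Proof.
move=> C0 mS mS' SS'; rewrite !joint_lawU// -ge0_integralZl//; last first.
  exact: measurable_fun_xsection.
have E (A : set (k.-tuple R * R)) u :
    distribution P Z (xsection A u) = P [set t | A (u, Z t)].
  by congr (P _); apply/seteqP; split => t /=; rewrite /xsection /= inE.
apply: ge0_le_integral => //.
- exact: measurable_fun_xsection.
- by apply: measurable_funeM; exact: measurable_fun_xsection.
- by move=> u _; rewrite !E.
Qed.

End independent_radius.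

(** * Reflections and the uniform distribution on the sphere *)

Section dot_product.
Context {R : realType} {k : nat}.
Implicit Types (u v n : 'cV[R]_k) (B : 'M[R]_k).

Definition dot u v : R := (u^T *m v) 0 0.

Lemma dotE u v : dot u v = \sum_i u i 0 * v i 0.
Proof. by rewrite /dot mxE; apply: eq_bigr => i _; rewrite mxE. Qed.

Lemma dotC u v : dot u v = dot v u.
Proof. by rewrite !dotE; apply: eq_bigr => i _; rewrite mulrC. Qed.

Lemma dotDr u v n : dot u (v + n) = dot u v + dot u n.
Proof. by rewrite /dot mulmxDr mxE. Qed.

Lemma dotZr a u v : dot u (a *: v) = a * dot u v.
Proof. by rewrite /dot -scalemxAr mxE. Qed.

Lemma dotNr u v : dot u (- v) = - dot u v.
Proof. by rewrite -scaleN1r dotZr mulN1r. Qed.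

Lemma dotDl u v n : dot (u + v) n = dot u n + dot v n.
Proof. by rewrite dotC dotDr !(dotC n). Qed.

Lemma dotZl a u v : dot (a *: u) v = a * dot u v.
Proof. by rewrite dotC dotZr dotC. Qed.

Lemma dotNl u v : dot (- u) v = - dot u v.
Proof. by rewrite dotC dotNr dotC. Qed.

Lemma dot_mulmx B u v : dot (B *m u) v = dot u (B^T *m v).
Proof. by rewrite /dot trmx_mul mulmxA. Qed.

Lemma dot_ge0 u : 0 <= dot u u.
Proof. by rewrite dotE; apply: sumr_ge0 => i _; rewrite -expr2 sqr_ge0. Qed.

Lemma dot_eq0 u : dot u u = 0 -> u = 0.
Proof.
rewrite dotE => h; apply/colP => i; rewrite mxE.
have /eqP : u i 0 * u i 0 = 0.
  by apply: (psumr_eq0P _ h) => // j _; rewrite -expr2 sqr_ge0.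
by rewrite mulf_eq0 orbb => /eqP.
Qed.

Lemma dot_gt0 u : u != 0 -> 0 < dot u u.
Proof.
by move=> u0; rewrite lt_neqAle dot_ge0 andbT eq_sym; apply: contra u0 => /eqP/dot_eq0->.
Qed.

Lemma dot_orthogonal B u v : B^T *m B = 1%:M -> dot (B *m u) (B *m v) = dot u v.
Proof. by move=> BB; rewrite dot_mulmx mulmxA BB mul1mx. Qed.

Lemma cauchy_schwarz u v : dot u v ^+ 2 <= dot u u * dot v v.
Proof.
have [->|v0] := eqVneq v 0.
  by rewrite /dot !mulmx0 mxE expr0n mulr0.
have vv := dot_gt0 v0.
have := dot_ge0 (dot v v *: u - dot u v *: v).
rewrite !(dotDl, dotDr, dotZl, dotZr, dotNl, dotNr) (dotC v u) => h.
have {}h : 0 <= dot v v * (dot u u * dot v v - dot u v ^+ 2) by lra.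
by move: h; rewrite pmulr_rge0// subr_ge0.
Qed.

Lemma dot_le u v (M N : R) : 0 <= M -> 0 <= N ->
  dot u u <= M ^+ 2 -> dot v v <= N ^+ 2 -> `|dot u v| <= M * N.
Proof.
move=> M0 N0 uM vN; rewrite -(@ler_pXn2r _ 2)// ?nnegrE ?mulr_ge0//.
rewrite real_normK ?num_real// exprMn; apply: (le_trans (cauchy_schwarz u v)).
by apply: ler_pM => //; exact: dot_ge0.
Qed.

Definition householder n : 'M[R]_k := 1%:M - (2 / dot n n) *: (n *m n^T).

Lemma mul_householder n u :
  householder n *m u = u - (2 / dot n n * dot n u) *: n.
Proof.
rewrite mulmxBl mul1mx -scalemxAl -mulmxA -scalerA; congr (_ - _ *: _).
apply/colP => i; rewrite mxE big_ord1 /dot.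
by rewrite [in RHS]mxE mulrC.
Qed.

Lemma householder_orthogonal n : n != 0 -> (householder n)^T *m householder n = 1%:M.
Proof.
move=> n0; have nn := dot_gt0 n0.
have -> : (householder n)^T = householder n.
  by rewrite /householder linearB/= linearZ/= trmx_mul trmxK trmx1.
have H u : householder n *m (householder n *m u) = u.
  rewrite !mul_householder dotDr dotNr dotZr.
  rewrite -[in LHS]addrA -opprD -scalerDl.
  have -> : 2 / dot n n * dot n u + 2 / dot n n *
     (dot n u - 2 / dot n n * dot n u * dot n n) = 0.
    by field; rewrite gt_eqF.
  by rewrite scale0r subr0.
apply/matrixP => a b; have /colP/(_ a) := H (delta_mx b 0).
by rewrite mulmxA -colE [LHS]mxE => ->; rewrite !mxE eqxx andbT.
Qed.

(** The reflection along f - e exchanges the two unit vectors; invariance is assumed under all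
    orthogonal matrices, so a reflection is good enough. *)
Lemma exists_rotation (e f : 'cV[R]_k) : dot e e = 1 -> dot f f = 1 ->
  exists2 O : 'M[R]_k, O^T *m O = 1%:M & O *m f = e.
Proof.
move=> ee ff; have [->|ef] := eqVneq e f.
  by exists 1%:M; rewrite ?mul1mx// trmx1 mul1mx.
exists (householder (f - e)).
  by apply: householder_orthogonal; rewrite subr_eq0 eq_sym.
have n0 : 0 < dot (f - e) (f - e) by apply: dot_gt0; rewrite subr_eq0 eq_sym.
rewrite mul_householder.
have -> : 2 / dot (f - e) (f - e) * dot (f - e) f = 1.
  move: n0; rewrite !(dotDl, dotDr, dotNl, dotNr) (dotC e f) ee ff => n0.
  by field; rewrite gt_eqF//; lra.
by rewrite scale1r opprB addrC subrK.
Qed.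

End dot_product.

(** [r] bounds the squared distance. *)
Definition ball_around (R : realType) (k : nat) (e : 'cV[R]_k) (r : R) :
    set (k.-tuple R) :=
  [set v | dot (tvec v - e) (tvec v - e) < r].

Lemma measurable_dot_tvec (R : realType) (k : nat) (e : 'cV[R]_k) :
  measurable_fun [set: k.-tuple R] (fun v => dot (tvec v - e) (tvec v - e)).
Proof.
rewrite (_ : (fun v => _) = fun v => \sum_i (tnth v i - e i 0) * (tnth v i - e i 0)).
  by apply: measurable_sum => i; apply: measurable_funM; apply: measurable_funB => //;
    exact: measurable_tnth.
by apply/funext => v; rewrite dotE; apply: eq_bigr => i _; rewrite !mxE.
Qed.

Lemma measurable_ltr_set (R : realType) d (T : measurableType d) (f g : T -> R) :
  measurable_fun [set: T] f -> measurable_fun [set: T] g ->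
  measurable [set x | f x < g x].
Proof.
move=> mf mg; rewrite -[X in measurable X]setTI.
exact: (measurable_fun_ltr mf mg measurableT (Y := [set true])).
Qed.

Lemma measurable_ball_around (R : realType) (k : nat) (e : 'cV[R]_k) (r : R) :
  measurable (ball_around e r).
Proof. by apply: measurable_ltr_set => //; exact: measurable_dot_tvec. Qed.

Section caps.
Context {R : realType} {k : nat} {d : measure_display} {T : measurableType d}
  {P : probability T R} (U : 'I_k -> {RV P >-> R}).
Hypothesis U_unif : uniform_on_sphere U.

Let rU := rtuple (fun i t => U i t).

Lemma ball_around_prob (e f : 'cV[R]_k) (r : R) :
  dot e e = 1 -> dot f f = 1 ->
  P (rU @^-1` ball_around f r) = P (rU @^-1` ball_around e r).
Proof.
move=> ee ff; have [B BB Bfe] := exists_rotation ee ff.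
rewrite -(uniform_rotation U_unif BB (measurable_ball_around e r)).
congr (P _); apply/seteqP.
have E t : dot (tvec (rtuple (mulmx_vec B (fun i t => U i t)) t) - e)
               (tvec (rtuple (mulmx_vec B (fun i t => U i t)) t) - e) =
           dot (tvec (rU t) - f) (tvec (rU t) - f).
  have -> : tvec (rtuple (mulmx_vec B (fun i t => U i t)) t) - e = B *m (tvec (rU t) - f).
    rewrite mulmxBr Bfe !tvec_rtuple; congr (_ - _).
    by apply/colP => i; rewrite [LHS]mxE.
  exact: dot_orthogonal.
by split => t /=; rewrite /ball_around /= E.
Qed.

(* All balls of a given radius centred on the sphere have the same probability, and
   countably many of them cover it. *)
Lemma cap_gt0 (e : 'cV[R]_k) (r : R) : dot e e = 1 -> 0 < r ->
  (0 < P (rU @^-1` ball_around e r))%E.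
Proof.
move=> ee r0; rewrite lt0e measure_ge0 andbT; apply/eqP => P0.
have mrU : measurable_fun [set: T] rU by apply: measurable_rtuple.
have balls0 f : dot f f = 1 -> P.-negligible (rU @^-1` ball_around f r).
  move=> ff; apply/negligibleP; last exact: etrans (ball_around_prob r ee ff) P0.
  by rewrite -[X in measurable X]setTI; apply: mrU => //; exact: measurable_ball_around.
(* Two points of a cell differ by less than h in each coordinate; as h <= 1 the squares are at most
   h, and k h < r. *)
pose h : R := Num.min 1 (r / (4 * (k%:R + 1))).
have k0 : 0 < k%:R + 1 :> R by rewrite ltr_wpDl.
have h0 : 0 < h by rewrite lt_min ltr01 divr_gt0// mulr_gt0.
pose near_q (q : {ffun 'I_k -> rat}) : set T :=
  [set t | dot (tvec (rU t)) (tvec (rU t)) = 1 /\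
           forall i, `|tnth (rU t) i - ratr (q i)| < h / 2].
have near_q0 q : P.-negligible (near_q q).
  (* Rational centres need not lie on the sphere, so a non-empty cell is enclosed in the ball about
     the direction of one of its own points. *)
  have [[t [ft fq]]|no] := pselect (near_q q !=set0); last first.
    by rewrite (_ : near_q q = set0); [exact: negligible_set0|apply: contrapT => /eqP/set0P].
  apply: negligibleS (balls0 _ ft) => s [fs sq] /=.
  rewrite /ball_around /= dotE.
  have H i : ((tvec (rU s) - tvec (rU t)) i 0) * ((tvec (rU s) - tvec (rU t)) i 0) <= h.
    have := fq i; have := sq i; rewrite !mxE -expr2 !ltr_norml => /andP[a1 a2] /andP[b1 b2].
    have : `|tnth (rU s) i - tnth (rU t) i| <= h by rewrite ler_norml; apply/andP; split; lra.
    have h1 : h <= 1 by rewrite ge_min lexx.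
    move=> H; rewrite -real_normK ?num_real//; apply: le_trans H.
    by rewrite expr2 ler_piMl//; apply: le_trans h1; rewrite ler_norml; apply/andP; split; lra.
  apply: (@le_lt_trans _ _ (\sum_(i < k) h)); first by apply: ler_sum.
  rewrite sumr_const card_ord -mulr_natr.
  have : h <= r / (4 * (k%:R + 1)) by rewrite ge_min lexx orbT.
  rewrite ler_pdivlMr ?mulr_gt0// => H1.
  have kk : 0 <= k%:R :> R by [].
  nra.
have : P.-negligible [set: T].
  pose A n := if unpickle n is Some q then near_q q else set0.
  have A0 n : P.-negligible (A n).
    by rewrite /A; case: (unpickle n) => [q|]; [exact: near_q0|exact: negligible_set0].
  have S0 : P.-negligible (~` [set t | \sum_(i < k) U i t ^+ 2 = 1]) by exact: U_unif.1.
  apply: negligibleS (negligibleU (negligible_bigcup A0) S0) => t _.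
  have [tS|] := pselect (\sum_(i < k) U i t ^+ 2 = 1); [left|by right].
  have /choice[q Hq] : forall i : 'I_k, exists q : rat, `|tnth (rU t) i - ratr q| < h / 2.
    move=> i; have [|q] := @rat_in_itvoo R (tnth (rU t) i - h / 2) (tnth (rU t) i + h / 2).
      lra.
    rewrite in_itv/= => /andP[q1 q2]; exists q.
    by rewrite ltr_norml; apply/andP; split; lra.
  exists (pickle (finfun q : {ffun 'I_k -> rat})) => //.
  rewrite /A pickleK; split; last by move=> i; rewrite ffunE.
  by rewrite dotE tvec_rtuple -tS; apply: eq_bigr => i _; rewrite mxE expr2.
move/negligibleP => /(_ measurableT) PT0.
by have := etrans (esym (probability_setT P)) PT0 => /eqP; rewrite onee_eq0.
Qed.

End caps.

(** * The quadratic programme *)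

Lemma continuous_sumr (R : realType) (T : topologicalType) (n : nat)
    (f : 'I_n -> T -> R) :
  (forall i, continuous (f i)) -> continuous (fun x => \sum_i f i x).
Proof.
move=> fc x; apply: (@cvg_big _ _ +%R 0 xpredT); first exact: add_continuous.
by move=> i _; exact: fc.
Qed.

Section simplex_minimum.
Context {R : realType} {k : nat} (S : 'M[R]_k) (I : {set 'I_k}).

(** Coordinates outside [I] are pinned to 0 rather than removed, so that the programme stays in R^k;
    row vectors are the shape required by [rV_compact] and [EVT_min_rV]. *)
Definition simplex : set 'rV[R]_k :=
  [set x | forall i, (if i \in I then `[0, 1]%classic else [set 0 : R]) (x ord0 i)] `&`
  [set x | \sum_i x ord0 i = 1].

Lemma compact_simplex : compact simplex.
Proof.
apply: compact_closedI.
  apply: (@rV_compact R k (fun i : 'I_k => if i \in I then `[0, 1]%classic else [set 0 : R])) => i.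
  by case: ifP => _; [exact: segment_compact|exact: compact_set1].
apply: (@closed_comp _ _ (fun x : 'rV[R]_k => \sum_i x ord0 i) [set 1]);
  last exact: closed_eq.
by move=> x _; apply: continuous_sumr => i; exact: coord_continuous.
Qed.

Lemma simplex_minimizer : I != finset.set0 ->
  exists2 c : 'cV[R]_k, simplex c^T &
    forall b : 'cV[R]_k, simplex b^T -> dot c (S *m c) <= dot b (S *m b).
Proof.
move=> /set0Pn[i0 i0I].
pose f (x : 'rV[R]_k) := \sum_i \sum_j x ord0 i * S i j * x ord0 j.
have fE (b : 'cV[R]_k) : dot b (S *m b) = f b^T.
  rewrite dotE; apply: eq_bigr => i _; rewrite mxE mulr_sumr.
  by apply: eq_bigr => j _; rewrite !mxE mulrA.
have [||c] := @EVT_min_rV R k f simplex _ compact_simplex.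
- exists (delta_mx 0 i0); split => /=.
    move=> i; rewrite mxE eqxx/=; case: ifPn => iI; last first.
      by have [ii0|//] := eqVneq i i0; rewrite ii0 i0I in iI.
    by rewrite /= in_itv/=; case: eqP; rewrite ?lexx ler01.
  rewrite (bigD1 i0)//= mxE !eqxx big1 ?addr0// => i ii0.
  by rewrite mxE (negbTE ii0) andbF.
- apply: continuous_subspaceT; apply: continuous_sumr => i.
  apply: continuous_sumr => j x.
  have ci (l : 'I_k) : {for x, continuous (fun x : 'rV[R]_k => x ord0 l)}.
    exact: coord_continuous.
  apply: continuousM (ci j); apply: continuousM (ci i) _; exact: cst_continuous.
- rewrite inE => cS cmin; exists c^T; first by rewrite trmxK.
  by move=> b bS; rewrite !fE trmxK; apply: cmin; rewrite inE.
Qed.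

End simplex_minimum.

(** First-order condition at a minimum. If a < 0, the chosen e makes e |q| at most half of |a|, and
    the linear term wins. *)
Lemma ge0_of_quadratic (R : realFieldType) (a q : R) :
  (forall e, 0 < e -> e <= 1 -> 0 <= e * a + e ^+ 2 * q) -> 0 <= a.
Proof.
move=> h; rewrite leNgt; apply/negP => a0.
pose e := Num.min 1 (- a / (2 * (`|q| + 1))).
have q1 : 0 < 2 * (`|q| + 1) by rewrite mulr_gt0// ltr_wpDl.
have e0 : 0 < e by rewrite lt_min ltr01 divr_gt0// oppr_gt0.
have e1 : e <= 1 by rewrite ge_min lexx.
have : e <= - a / (2 * (`|q| + 1)) by rewrite ge_min lexx orbT.
rewrite ler_pdivlMr// => e2.
have := h e e0 e1; rewrite expr2 -mulrA -mulrDr pmulr_rge0//.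
have := ler_norm q; have := normr_ge0 q; nra.
Qed.

Section quadratic_programme.
Context {R : realType} {k : nat} (S : 'M[R]_k) (I : {set 'I_k}).
Hypothesis S_sym : S^T = S.
Hypothesis S_pos : forall u : 'cV[R]_k, u != 0 -> 0 < dot u (S *m u).

(* [c] solves the dual programme; the primal minimiser is [S *m c]. *)
Definition qp_dual (J : {set 'I_k}) (c : 'cV[R]_k) : Prop :=
  [/\ forall i, 0 <= c i 0,
      forall i, i \notin J -> c i 0 = 0,
      forall i, i \in J -> 1 <= (S *m c) i 0 &
      forall i, 0 < c i 0 -> (S *m c) i 0 = 1].

Lemma dot_mulmxS u v : dot (S *m u) v = dot u (S *m v).
Proof. by rewrite dot_mulmx S_sym. Qed.

(* Minimising the quadratic form over the simplex instead of the orthant gives a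
   compact domain; the dual solution is the minimiser divided by the minimum. *)
Lemma qp_dual_exists : I != finset.set0 -> exists c, qp_dual I c.
Proof.
move=> I0; have [c [cbox /= csum] cmin] := simplex_minimizer S I0.
have {}cbox i : (if i \in I then `[0, 1]%classic else [set 0 : R]) (c i 0).
  by have := cbox i; rewrite mxE.
have {}csum : \sum_i c i 0 = 1.
  by rewrite -csum; apply: eq_bigr => i _; rewrite mxE.
have c0 i : 0 <= c i 0.
  by have := cbox i; case: ifP => _ /=; [rewrite in_itv/= => /andP[]|move=> ->].
have coff i : i \notin I -> c i 0 = 0.
  by have := cbox i; case: ifP.
have cn0 : c != 0.
  apply/eqP => c00; have := csum; rewrite c00 big1; last by move=> i _; rewrite mxE.
  by move/eqP; rewrite eq_sym oner_eq0.
set m := dot c (S *m c); have m0 : 0 < m by exact: S_pos.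
(* Moving from c towards the vertex j stays in the simplex, so the directional derivative of the
   form is non-negative there. *)
have first_order j : j \in I -> m <= (S *m c) j 0.
  move=> jI; pose e : 'cV[R]_k := delta_mx j 0.
  have eE u : dot e u = u j 0.
    rewrite dotE (bigD1 j)//= mxE !eqxx mul1r big1 ?addr0// => i ij.
    by rewrite mxE (negbTE ij) mul0r.
  suff : 0 <= 2 * dot (e - c) (S *m c).
    by rewrite dotDl dotNl eE -/m; lra.
  apply: (@ge0_of_quadratic _ _ (dot (e - c) (S *m (e - c)))) => h h0 h1.
  have bS : simplex I (c + h *: (e - c))^T.
    split => /=.
      move=> i; have := cbox i; have := c0 i; rewrite !mxE eqxx andbT.
      case: ifPn => iI; rewrite /= ?in_itv/=; last first.
        have [ij|_] := eqVneq i j; first by rewrite ij jI in iI.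
        by move=> _ ->; rewrite oppr0 addr0 mulr0 addr0.
      move=> _ /andP[a1 a2]; case: eqP => _ /=; apply/andP; split; nra.
    under eq_bigr do rewrite !mxE eqxx andbT.
    rewrite big_split/= csum -mulr_sumr sumrB csum (bigD1 j)//= eqxx big1 ?addr0 ?subrr ?mulr0 ?addr0//.
    by move=> i /negbTE->.
  have := cmin _ bS; set dl := e - c.
  rewrite mulmxDr -scalemxAr !(dotDl c) !(dotDr _ (S *m c)) !(dotZl, dotZr) -/m.
  by rewrite -(dot_mulmxS c dl) (dotC (S *m c)); lra.
(* Complementary slackness: the terms c_i ((S c)_i - m) are non-negative and add up to m - m = 0. *)
have slack i : 0 < c i 0 -> (S *m c) i 0 = m.
  move=> ci; have iI : i \in I by apply: contraTT ci => /coff->; rewrite ltxx.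
  have H : \sum_i c i 0 * ((S *m c) i 0 - m) = 0.
    under eq_bigr do rewrite mulrBr.
    by rewrite sumrB -mulr_suml csum mul1r -dotE subrr.
  have /eqP : c i 0 * ((S *m c) i 0 - m) = 0.
    apply: (psumr_eq0P _ H) => // j _.
    have [jI|/coff->] := boolP (j \in I); last by rewrite mul0r.
    by rewrite mulr_ge0// subr_ge0 first_order.
  by rewrite mulf_eq0 gt_eqF//= subr_eq0 => /eqP.
exists (m^-1 *: c); split => i.
- by rewrite mxE mulr_ge0// invr_ge0 ltW.
- by move=> /coff ci; rewrite mxE ci mulr0.
- by move=> iI; rewrite -scalemxAr mxE mulrC ler_pdivlMr// mul1r first_order.
- rewrite mxE pmulr_rgt0 ?invr_gt0// => /slack ci.
  by rewrite -scalemxAr mxE ci mulVf// gt_eqF.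
Qed.

Lemma subvec_set_sub1E (J : {set 'I_k}) (y : 'cV[R]_k) (b : 'I_#|J|) :
  (subvec_set y J - ones R #|J|) b 0 = y (enum_val b) 0 - 1.
Proof. by rewrite mxE [X in X + _ = _]mxE; congr (_ + _); rewrite !mxE. Qed.

Definition supported (J : {set 'I_k}) (c : 'cV[R]_k) := forall i, i \notin J -> c i 0 = 0.

Lemma sum_supported (J : {set 'I_k}) c (f : 'I_k -> R) : supported J c ->
  \sum_i f i * c i 0 = \sum_(a < #|J|) f (enum_val a) * c (enum_val a) 0.
Proof.
move=> cJ; rewrite -(big_enum_val (fun i => f i * c i 0)) [RHS]big_mkcond/=.
by apply: eq_bigr => i _; case: ifPn => // /cJ ->; rewrite mulr0.
Qed.

(** For vectors supported on [K], block computations can be carried out in R^k, without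
    reindexing. *)
Lemma submx_set_mul J K c : supported K c ->
  submx_set S J K *m subvec_set c K = subvec_set (S *m c) J.
Proof.
move=> cK; apply/colP => a; rewrite !mxE (sum_supported _ cK).
by apply: eq_bigr => b _; rewrite !mxE.
Qed.

(** Padding by zeros; the sum has at most one non-zero term, which spares a membership proof when
    converting the index. *)
Definition extend (K : {set 'I_k}) (v : 'cV[R]_#|K|) : 'cV[R]_k :=
  \col_i \sum_(b < #|K|) (if enum_val b == i then v b 0 else 0).

Lemma extend_supported K v : supported K (@extend K v).
Proof.
move=> i iK; rewrite mxE big1// => b _; case: eqP => // bi.
by move: iK; rewrite -bi enum_valP.
Qed.

Lemma subvec_extend K v : subvec_set (@extend K v) K = v.
Proof.
apply/colP => a; rewrite !mxE (bigD1 a)//= eqxx big1 ?addr0// => b ba.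
by rewrite (inj_eq enum_val_inj) (negbTE ba).
Qed.

(** A kernel vector of the principal submatrix, padded by zeros, would be a zero of the positive
    definite form. *)
Lemma submx_set_unit K : submx_set S K K \in unitmx.
Proof.
rewrite -unitmx_tr -row_free_unit; apply: inj_row_free => v vS.
have uK := extend_supported v^T; set u := extend _ in uK.
have Su : subvec_set (S *m u) K = 0.
  rewrite -(submx_set_mul _ uK) subvec_extend -[LHS]trmxK trmx_mul trmxK vS.
  by rewrite trmx0.
have u0 : u = 0.
  apply/eqP; apply: contraT => /S_pos; rewrite dotE.
  rewrite (eq_bigr (fun i => (S *m u) i 0 * u i 0)); last by move=> i _; rewrite mulrC.
  rewrite (sum_supported _ uK) big1 ?ltxx// => a _.
  by have /colP/(_ a) := Su; rewrite [LHS]mxE => ->; rewrite mxE mul0r.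
have := subvec_extend v^T; rewrite -/u u0 => /(congr1 trmx); rewrite trmxK => <-.
by apply/matrixP => a b; rewrite !mxE.
Qed.

Lemma inv_onesE K c : supported K c -> (forall i, i \in K -> (S *m c) i 0 = 1) ->
  inv_ones S K = subvec_set c K.
Proof.
move=> cK Sc; rewrite /inv_ones -[RHS](mulKmx (submx_set_unit K)) submx_set_mul//.
by congr (_ *m _); apply/colP => a; rewrite !mxE -(Sc _ (enum_valP a)) mxE.
Qed.

Lemma qp_dual_dot c c' : qp_dual I c -> qp_dual I c' ->
  \sum_i c i 0 <= dot c (S *m c').
Proof.
move=> [c0 cI _ _] [_ _ Sc' _]; rewrite dotE; apply: ler_sum => i _.
have [iI|/cI->] := boolP (i \in I); last by rewrite mul0r.
by rewrite ler_peMr// Sc'.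
Qed.

Lemma qp_dual_dotE c : qp_dual I c -> dot c (S *m c) = \sum_i c i 0.
Proof.
move=> [c0 _ _ cS]; rewrite dotE; apply: eq_bigr => i _.
have := c0 i; rewrite le_eqVlt => /predU1P[<-|/cS->]; first by rewrite mul0r.
by rewrite mulr1.
Qed.

(** The form at c - c' equals the sums of c and of c' minus the two cross terms, which [qp_dual_dot]
    bounds below by these very sums. *)
Lemma qp_dual_unique c c' : qp_dual I c -> qp_dual I c' -> c = c'.
Proof.
move=> Dc Dc'; apply/eqP; rewrite -subr_eq0; apply: contraT => /S_pos.
rewrite mulmxBr !(dotDl, dotNl, dotDr, dotNr) !qp_dual_dotE//.
by have := qp_dual_dot Dc Dc'; have := qp_dual_dot Dc' Dc; lra.
Qed.

Definition support (c : 'cV[R]_k) : {set 'I_k} := [set i | 0 < c i 0].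

Lemma qp_dual_supported c : qp_dual I c -> supported (support c) c.
Proof.
by move=> [c0 _ _ _] i; rewrite inE -leNgt => ci; apply/eqP; rewrite eq_le ci c0.
Qed.

Lemma qp_dual_inv_ones c : qp_dual I c ->
  inv_ones S (support c) = subvec_set c (support c).
Proof.
move=> Dc; apply: inv_onesE; first exact: qp_dual_supported Dc.
by case: Dc => _ _ _ cS i; rewrite inE => /cS.
Qed.

Lemma qp_dual_active c : I != finset.set0 -> qp_dual I c -> qp_active_set S I (support c).
Proof.
move=> I0 Dc; have cE := qp_dual_inv_ones Dc; have cK := qp_dual_supported Dc.
case: (Dc) => c0 cI Sc cS; split.
- by apply/fintype.subsetP => i; rewrite inE; apply: contraTT => /cI->; rewrite ltxx.
- rewrite lt0n; apply/eqP => K0.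
  have c00 : c = 0.
    by apply/colP => i; rewrite mxE cK// (cards0_eq K0) inE.
  have /set0Pn[i iI] := I0; have := Sc i iI.
  by rewrite c00 mulmx0 mxE ler10.
- by move=> a; rewrite cE mxE; have := enum_valP a; rewrite inE.
- move=> _ b; rewrite cE (submx_set_mul _ cK) subvec_set_sub1E subr_ge0.
  by have := enum_valP b; rewrite inE => /andP[_ /Sc].
Qed.

(** Converse of [qp_dual_active]: padding the vector [inv_ones S K] by zeros gives a dual solution.
    Uniqueness of the active set thereby reduces to that of the dual solution. *)
Lemma active_qp_dual K : qp_active_set S I K ->
  exists2 c, qp_dual I c & K = support c.
Proof.
move=> [KI _ Kpos Mpos].
have cK := extend_supported (inv_ones S K).
have cE := subvec_extend (inv_ones S K).
set c := extend _ in cK cE.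
have Sc i : i \in K -> (S *m c) i 0 = 1.
  move=> iK; have : subvec_set (S *m c) K = ones R #|K|.
    by rewrite -(submx_set_mul _ cK) cE /inv_ones mulKVmx// submx_set_unit.
  by move/colP => /(_ (enum_rank_in iK i)); rewrite [LHS]mxE enum_rankK_in// => ->; rewrite mxE.
have cpos i : i \in K -> 0 < c i 0.
  move=> iK; have := Kpos (enum_rank_in iK i).
  by rewrite -cE mxE enum_rankK_in.
have c0 i : 0 <= c i 0.
  by have [/cpos/ltW//|/cK->] := boolP (i \in K).
exists c; last first.
  apply/setP => i; rewrite inE; have [/cpos->//|/cK->] := boolP (i \in K).
  by rewrite ltxx.
split => // i.
- by move=> iI; apply: cK; apply: contra iI; exact: (fintype.subsetP KI).
- move=> iI; have [/Sc->//|iK] := boolP (i \in K).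
  have iM : i \in I :\: K by rewrite inE iK.
  have M0 : I :\: K != finset.set0 by apply/set0Pn; exists i.
  have := Mpos M0 (enum_rank_in iM i).
  by rewrite -cE (submx_set_mul _ cK) subvec_set_sub1E enum_rankK_in// subr_ge0.
- by have [/Sc//|/cK->] := boolP (i \in K); rewrite ltxx.
Qed.

(** Rewrites the primal objective, which involves an inverse block, as the form of the full matrix
    at a padded vector, where it can be compared with the dual. *)
Lemma qform_extend (y : 'cV[R]_k) : exists d, [/\ supported I d,
  forall i, i \in I -> (S *m d) i 0 = y i 0 & qform S I y = dot d (S *m d)].
Proof.
pose v := invmx (submx_set S I I) *m subvec_set y I.
have dI := extend_supported v; have dE := subvec_extend v.
exists (extend v); set d := extend v in dI dE *.
have Sd : subvec_set (S *m d) I = subvec_set y I.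
  by rewrite -(submx_set_mul _ dI) dE mulKVmx// submx_set_unit.
split => //.
  move=> i iI; have /colP/(_ (enum_rank_in iI i)) := Sd.
  by rewrite [LHS]mxE [RHS]mxE enum_rankK_in.
rewrite /qform -mulmxA -/v dotC dotE (sum_supported _ dI) mxE.
by apply: eq_bigr => a _; rewrite -Sd -dE !mxE.
Qed.

Lemma dot_supported (J : {set 'I_k}) c (u v : 'cV[R]_k) : supported J c ->
  (forall i, i \in J -> u i 0 = v i 0) -> dot c u = dot c v.
Proof.
move=> cJ uv; rewrite !dotE; apply: eq_bigr => i _.
by have [/uv->|/cJ->] := boolP (i \in J); rewrite ?mul0r.
Qed.

Lemma qp_dual_feasible c : qp_dual I c -> qp_feasible I (S *m c).
Proof. by case. Qed.

Lemma qform_qp_dual c : qp_dual I c -> qform S I (S *m c) = \sum_i c i 0.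
Proof.
move=> Dc; have [d [dI Sd ->]] := qform_extend (S *m c).
have cI : supported I c by case: Dc.
have -> : d = c.
  apply/eqP; rewrite -subr_eq0; apply: contraT => /S_pos.
  rewrite (@dot_supported I _ _ 0) ?/dot ?mulmx0 ?mxE ?ltxx//.
    by move=> i iI; rewrite !mxE dI// cI// subrr.
  by move=> i iI; rewrite mulmxBr [LHS]mxE [X in _ + X]mxE Sd// subrr mxE.
exact: qp_dual_dotE.
Qed.

(** When the form at d - c is expanded, the cross term is c . y, at least the sum of c since y >= 1
    on [I]. Non-negativity of the form gives optimality of c; the case of a zero gap decides the
    strict bounds. *)
Lemma qform_gap c y : qp_dual I c -> qp_feasible I y ->
  exists2 d, (forall i, i \in I -> (S *m d) i 0 = y i 0) &
    dot (d - c) (S *m (d - c)) <= qform S I y - \sum_i c i 0.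
Proof.
move=> Dc yI; have [d [dI Sd ->]] := qform_extend y; exists d => //.
have cI : supported I c by case: Dc.
rewrite mulmxBr !(dotDl, dotNl, dotDr, dotNr) (qp_dual_dotE Dc) -(dot_mulmxS d c) (dotC _ c).
have : \sum_i c i 0 <= dot c (S *m d).
  rewrite (dot_supported cI Sd) dotE; apply: ler_sum => i _.
  have [iI|/cI->] := boolP (i \in I); last by rewrite mul0r.
  by case: Dc => c0 _ _ _; rewrite ler_peMr// yI.
lra.
Qed.

Lemma qform_ge c y : qp_dual I c -> qp_feasible I y -> \sum_i c i 0 <= qform S I y.
Proof.
move=> Dc yI; have [d _ gap] := qform_gap Dc yI.
rewrite -subr_ge0; apply: le_trans gap.
by have [->|/S_pos/ltW//] := eqVneq (d - c) 0; rewrite mulmx0 /dot mulmx0 mxE.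
Qed.

Lemma qp_minE c : qp_dual I c -> qp_min S I = \sum_i c i 0.
Proof.
move=> Dc; apply/eqP; rewrite eq_le; apply/andP; split.
  apply: ge_inf.
    by exists (\sum_i c i 0) => _ [y yI <-]; exact: qform_ge.
  by exists (S *m c); [exact: qp_dual_feasible|exact: qform_qp_dual].
apply: lb_le_inf.
  by exists (\sum_i c i 0), (S *m c); [exact: qp_dual_feasible|exact: qform_qp_dual].
by move=> _ [y yI <-]; exact: qform_ge.
Qed.

End quadratic_programme.

(** * Small rotations *)

Lemma normrM_le (R : realDomainType) (x y X Y : R) :
  `|x| <= X -> `|y| <= Y -> `|x * y| <= X * Y.
Proof. by move=> xX yY; rewrite normrM ler_pM. Qed.

Section small_rotation.
Context {R : realType} {k : nat} (e xi : 'cV[R]_k).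
Hypothesis ee : dot e e = 1.
Hypothesis exi : dot e xi = 0.

(** Reflecting along e and then along this vector rotates by twice the angle between them, so e
    moves to e + h xi up to order h^2. The product is exactly orthogonal and rational in h, so no
    trigonometric function is needed. *)
Definition rotation_axis (h : R) : 'cV[R]_k := e + (h / 2) *: xi.

Definition small_rotation (h : R) : 'M[R]_k :=
  householder (rotation_axis h) *m householder e.

Lemma rotation_axis_norm h :
  dot (rotation_axis h) (rotation_axis h) = 1 + h ^+ 2 * dot xi xi / 4.
Proof.
by rewrite !(dotDl, dotDr, dotZl, dotZr) (dotC xi) exi ee; field.
Qed.

Lemma rotation_axis_norm_ge1 h : 1 <= dot (rotation_axis h) (rotation_axis h).
Proof.
by rewrite rotation_axis_norm lerDl divr_ge0// mulr_ge0 ?sqr_ge0 ?dot_ge0.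
Qed.

Lemma small_rotation_orthogonal h : (small_rotation h)^T *m small_rotation h = 1%:M.
Proof.
have nz (v : 'cV[R]_k) : 1 <= dot v v -> v != 0.
  by apply: contraTneq => ->; rewrite /dot mulmx0 mxE ler10.
rewrite trmx_mul -mulmxA (mulmxA _^T (householder (rotation_axis h))).
rewrite householder_orthogonal; last exact/nz/rotation_axis_norm_ge1.
by rewrite mul1mx householder_orthogonal// nz// ee.
Qed.

(** Every term on the right carries h and one more small factor: another h, or N - 1, or one of e .
    u - 1, a . e - a . u and xi . u, which vanish at u = e. *)
Lemma dot_small_rotation h (a u : 'cV[R]_k) (m : R) : dot a xi = m * dot a e ->
  let N := (dot (rotation_axis h) (rotation_axis h))^-1 in
  dot a (small_rotation h *m u) - (1 + h * m) * dot a u =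
    - (h * (N * h * dot xi xi / 2 * dot e u * dot a e)) +
    h * (m * ((N - 1) * dot e u * dot a e + (dot e u - 1) * dot a e + (dot a e - dot a u))) -
    h * (N * dot xi u * dot a e) - h * (N * h / 2 * dot xi u * m * dot a e).
Proof.
move=> am N; rewrite /small_rotation -mulmxA !mul_householder.
have := rotation_axis_norm_ge1 h; rewrite /N rotation_axis_norm => n1.
rewrite ee divr1 /rotation_axis !(dotDl, dotDr, dotNl, dotNr, dotZl, dotZr) ee (dotC xi e) exi am.
by field; lra.
Qed.

Lemma small_rotation_estimate (D h del : R) (a u : 'cV[R]_k) (m : R) :
  1 <= D -> 0 < h -> h <= 1 -> 0 <= del -> dot xi xi <= D ^+ 2 -> `|m| <= D ->
  dot a a = 1 -> dot u u = 1 -> dot (u - e) (u - e) <= del ^+ 2 ->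
  dot a xi = m * dot a e ->
  `|dot a (small_rotation h *m u) - (1 + h * m) * dot a u| <= h * (3 * D ^+ 3 * (h + del)).
Proof.
move=> D1 h0 h1 del0 xiD mD aa uu ude am; rewrite (dot_small_rotation _ _ am).
have D0 : 0 <= D by lra.
have n1 := rotation_axis_norm_ge1 h; have nE := rotation_axis_norm h.
set n := dot (rotation_axis h) (rotation_axis h) in n1 nE *.
have n0 : 0 < n by lra.
have N0 : 0 <= n^-1 by rewrite invr_ge0 ltW.
have N1 : n^-1 <= 1 by rewrite invf_le1.
have X0 := dot_ge0 xi.
have Ndist : `|n^-1 - 1| <= h ^+ 2 * D ^+ 2 / 4.
  rewrite distrC ger0_norm ?subr_ge0//.
  have -> : 1 - n^-1 = (n - 1) * n^-1 by field; rewrite gt_eqF.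
  apply: (@le_trans _ _ (n - 1)); first by rewrite ler_piMr// subr_ge0.
  by rewrite nE; have := sqr_ge0 h; nra.
have one : 1 <= (1 : R) ^+ 2 by rewrite expr1n.
have w1 : `|dot e u| <= 1 by rewrite -[leRHS]mulr1 dot_le// ?ee ?uu.
have ae1 : `|dot a e| <= 1 by rewrite -[leRHS]mulr1 dot_le// ?ee ?aa.
have p1 : `|dot xi u| <= D by rewrite -[leRHS]mulr1 dot_le// uu.
have p2 : `|dot xi u| <= D * del.
  have -> : dot xi u = dot xi (u - e) by rewrite dotDr dotNr (dotC xi e) exi subr0.
  exact: dot_le.
have w2 : `|dot e u - 1| <= del.
  have -> : dot e u - 1 = dot e (u - e) by rewrite dotDr dotNr ee.
  by rewrite -[leRHS]mul1r dot_le// ee.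
have y2 : `|dot a e - dot a u| <= del.
  have -> : dot a e - dot a u = - dot a (u - e) by rewrite dotDr dotNr opprD opprK addrC.
  by rewrite normrN -[leRHS]mul1r dot_le// aa.
have Nn : `|n^-1| <= 1 by rewrite ger0_norm.
have hn : `|h| = h by rewrite gtr0_norm.
have T1 : `|n^-1 * h * dot xi xi / 2 * dot e u * dot a e| <= h * D ^+ 2 / 2.
  rewrite -[leRHS]mulr1 -[X in _ <= X * _]mulr1; apply: normrM_le => //; apply: normrM_le => //.
  rewrite normrM [X in _ * X]ger0_norm ?invr_ge0//; apply: ler_wpM2r; first by rewrite invr_ge0.
  apply: normrM_le; last by rewrite ger0_norm.
  by rewrite -[leRHS]mul1r; apply: normrM_le => //; rewrite hn.
have T2 : `|m * ((n^-1 - 1) * dot e u * dot a e + (dot e u - 1) * dot a e +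
    (dot a e - dot a u))| <= D * (h ^+ 2 * D ^+ 2 / 4 + del + del).
  apply: normrM_le => //; apply: le_trans (ler_normD _ _) _; apply: lerD => //.
  apply: le_trans (ler_normD _ _) _; apply: lerD.
    by rewrite -[leRHS]mulr1 -[X in _ <= X * _]mulr1; apply: normrM_le => //; apply: normrM_le.
  by rewrite -[leRHS]mulr1; apply: normrM_le.
have T3 : `|n^-1 * dot xi u * dot a e| <= D * del.
  by rewrite -[leRHS]mulr1 -[X in _ <= X * _]mul1r; apply: normrM_le => //; apply: normrM_le.
have T4 : `|n^-1 * h / 2 * dot xi u * m * dot a e| <= h / 2 * D * D.
  rewrite -[leRHS]mulr1; apply: normrM_le => //; apply: normrM_le => //; apply: normrM_le => //.
  rewrite normrM [X in _ * X]ger0_norm ?invr_ge0//; apply: ler_wpM2r; first by rewrite invr_ge0.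
  by rewrite -[leRHS]mul1r; apply: normrM_le => //; rewrite hn.
rewrite -mulrN -!mulrDr -!mulrBr normrM hn; apply: ler_wpM2l; first exact: ltW.
apply: (@le_trans _ _ (h * D ^+ 2 / 2 + D * (h ^+ 2 * D ^+ 2 / 4 + del + del) +
   D * del + h / 2 * D * D)).
  apply: le_trans (ler_normB _ _) _; apply: lerD => //.
  apply: le_trans (ler_normB _ _) _; apply: lerD => //.
  by apply: le_trans (ler_normD _ _) _; rewrite normrN; apply: lerD.
(* The bounds add up to h D^2 + h^2 D^3 / 4 + 3 del D; since D >= 1 and h <= 1, this is at most (5/4
   h + 3 del) D^3. *)
have DD : D <= D ^+ 3 by rewrite -[leLHS]expr1 ler_weXn2l.
have DD2 : D ^+ 2 <= D ^+ 3 by rewrite ler_weXn2l.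
have hh : h ^+ 2 <= h by rewrite expr2 ler_piMr// ltW.
have D30 : 0 <= D ^+ 3 by rewrite exprn_ge0.
have E1 : h * D ^+ 2 <= h * D ^+ 3 by apply: ler_wpM2l => //; exact: ltW.
have E2 : h ^+ 2 * D ^+ 3 <= h * D ^+ 3 by apply: ler_wpM2r.
have E3 : del * D <= del * D ^+ 3 by apply: ler_wpM2l.
have E4 : 0 <= h * D ^+ 3 by rewrite mulr_ge0// ltW.
have E5 : D * D ^+ 2 = D ^+ 3 by rewrite -exprS.
have -> : h * D ^+ 2 / 2 + D * (h ^+ 2 * D ^+ 2 / 4 + del + del) + D * del + h / 2 * D * D
  = h * D ^+ 2 + h ^+ 2 * (D * D ^+ 2) / 4 + 3 * (del * D) by field.
rewrite E5; lra.
Qed.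

End small_rotation.

(** * The rotation adapted to the quadratic programme *)

Section tilted_direction.
Context {R : realType} {k : nat} (A : 'M[R]_k) (I : {set 'I_k}) (c : 'cV[R]_k)
  (s : 'I_k -> R).
Hypothesis A_unit : A \in unitmx.
Hypothesis A_diag : forall i, (A^T *m A) i i = 1.
Hypothesis I_neq0 : I != finset.set0.
Hypothesis c_dual : qp_dual (A^T *m A) I c.

Let Sigma := A^T *m A.

Lemma gram_sym : Sigma^T = Sigma.
Proof. by rewrite trmx_mul trmxK. Qed.

Lemma dot_gram (u v : 'cV[R]_k) : dot u (Sigma *m v) = dot (A *m u) (A *m v).
Proof. by rewrite dot_mulmx mulmxA. Qed.

Lemma gram_pos (u : 'cV[R]_k) : u != 0 -> 0 < dot u (Sigma *m u).
Proof.
move=> u0; rewrite dot_gram; apply: dot_gt0; apply: contra u0 => /eqP Au.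
by rewrite -(mulKmx A_unit u) Au mulmx0.
Qed.

Definition qp_value : R := \sum_i c i 0.

Lemma qp_value_dot : dot (A *m c) (A *m c) = qp_value.
Proof. by rewrite -dot_gram (qp_dual_dotE c_dual). Qed.

Lemma qp_value_gt0 : 0 < qp_value.
Proof.
rewrite -qp_value_dot -dot_gram; apply: gram_pos; apply/eqP => c0.
have /set0Pn[i iI] := I_neq0; case: c_dual => _ _ /(_ i iI) + _.
by rewrite c0 mulmx0 mxE ler10.
Qed.

Let q := Num.sqrt qp_value.

Let q_gt0 : 0 < q. Proof. by rewrite sqrtr_gt0 qp_value_gt0. Qed.

Let q_sqr : q * q = qp_value.
Proof. by rewrite -expr2 sqr_sqrtr// ltW// qp_value_gt0. Qed.

Definition qp_direction : 'cV[R]_k := q^-1 *: (A *m c).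

Let e := qp_direction.

Lemma qp_direction_unit : dot e e = 1.
Proof.
by rewrite dotZl dotZr qp_value_dot -q_sqr; field; rewrite gt_eqF.
Qed.

Lemma dot_qp_direction (u : 'cV[R]_k) :
  dot e u = q^-1 * \sum_i c i 0 * (A^T *m u) i 0.
Proof. by rewrite dotZl dot_mulmx dotE. Qed.

Lemma qp_direction_ge i : i \in I -> q^-1 <= (A^T *m e) i 0.
Proof.
move=> iI; rewrite -scalemxAr mxE mulmxA -/Sigma.
rewrite -[leLHS]mulr1; apply: ler_wpM2l; first by rewrite invr_ge0 ltW.
by case: c_dual => _ _ + _; exact.
Qed.

(** Average the constraints with the weights c_i: the combination of the a_i is q e and the total
    weight is q^2. A unit vector for which g is nearly 1 / q must therefore be close to e. *)
Lemma gauge_le_dot (u : 'cV[R]_k) g : (forall i, i \in I -> g <= (A^T *m u) i 0) ->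
  q * g <= dot e u.
Proof.
move=> gu; rewrite dot_qp_direction -(ler_pM2l q_gt0) mulrA q_sqr mulVKf ?gt_eqF//.
rewrite mulr_suml; apply: ler_sum => i _; case: c_dual => c0 cI _ _.
have [iI|/cI->] := boolP (i \in I); last by rewrite !mul0r.
by apply: ler_wpM2l => //; exact: gu.
Qed.

Lemma dist_unit (u v : 'cV[R]_k) : dot u u = 1 -> dot v v = 1 ->
  dot (u - v) (u - v) = 2 - 2 * dot v u.
Proof.
by move=> uu vv; rewrite !(dotDl, dotNl, dotDr, dotNr) uu vv (dotC u v); ring.
Qed.

Lemma dot_unit_le1 (u v : 'cV[R]_k) : dot u u = 1 -> dot v v = 1 -> `|dot u v| <= 1.
Proof.
by move=> uu vv; rewrite -[leRHS]mulr1 dot_le// ?uu ?vv expr1n.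
Qed.

Lemma gauge_le (u : 'cV[R]_k) g : dot u u = 1 ->
  (forall i, i \in I -> g <= (A^T *m u) i 0) -> g <= q^-1.
Proof.
move=> uu /gauge_le_dot h; rewrite -(ler_pM2l q_gt0) divff ?gt_eqF//.
apply: le_trans h _; apply: le_trans (ler_norm _) _.
exact: (dot_unit_le1 qp_direction_unit uu).
Qed.

Definition tilt : R := (\sum_i c i 0 * s i) / qp_value.

(* Chosen so that rotating [e] by [h] towards [tilt_direction] multiplies
   [a_i . e] by [1 + h (s i - tilt)]; orthogonality to [e] is what fixes [tilt]. *)
Definition tilt_direction : 'cV[R]_k :=
  invmx A^T *m \col_i ((s i - tilt) * (A^T *m e) i 0).

Let xi := tilt_direction.
Let rho := tilt.

Let tiltE i : (A^T *m xi) i 0 = (s i - rho) * (A^T *m e) i 0.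
Proof. by rewrite mulKVmx ?unitmx_tr// mxE. Qed.

Lemma tilt_direction_orthogonal : dot e xi = 0.
Proof.
rewrite dot_qp_direction.
have -> : \sum_i c i 0 * (A^T *m xi) i 0 = q^-1 * (\sum_i c i 0 * s i - rho * qp_value).
  rewrite mulr_sumr -sumrB mulr_sumr; apply: eq_bigr => i _.
  rewrite tiltE -scalemxAr mxE mulmxA -/Sigma.
  case: c_dual => c0 _ _ cS; have := c0 i; rewrite le_eqVlt => /predU1P[<-|/cS].
    by rewrite !(mul0r, mulr0) subrr mulr0.
  by rewrite -/Sigma => ->; ring.
by rewrite divfK ?gt_eqF ?qp_value_gt0// subrr !mulr0.
Qed.

Definition tilt_rotation (h : R) : 'M[R]_k := small_rotation e xi h.

Lemma tilt_rotation_orthogonal h : (tilt_rotation h)^T *m tilt_rotation h = 1%:M.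
Proof. exact: small_rotation_orthogonal qp_direction_unit tilt_direction_orthogonal h. Qed.

Let dot_col (i : 'I_k) (u : 'cV[R]_k) : dot (col i A) u = (A^T *m u) i 0.
Proof. by rewrite /dot tr_col -row_mul mxE. Qed.

Let col_unit (i : 'I_k) : dot (col i A) (col i A) = 1.
Proof. by rewrite dot_col -(A_diag i) !mxE; apply: eq_bigr => j _; rewrite !mxE. Qed.

(** A single constant for all the bounds required by [small_rotation_estimate]; being at least 1, it
    also satisfies D <= D^2. *)
Definition tilt_bound : R := 1 + \sum_i `|s i - rho| + dot xi xi.

Let D := tilt_bound.

Let D_ge1 : 1 <= D.
Proof. by rewrite /D /tilt_bound -addrA lerDl addr_ge0 ?dot_ge0// sumr_ge0. Qed.

Let D_ge i : `|s i - rho| <= D.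
Proof.
rewrite /D /tilt_bound (bigD1 i)//= -!addrA (addrCA 1) lerDl.
by rewrite !addr_ge0 ?dot_ge0// sumr_ge0.
Qed.

Let D_xi : dot xi xi <= D ^+ 2.
Proof.
apply: (@le_trans _ _ D).
  by rewrite /D /tilt_bound lerDr addr_ge0// sumr_ge0.
by rewrite -[leLHS]expr1 ler_weXn2l.
Qed.

Lemma tilt_estimate (h del : R) (u : 'cV[R]_k) i :
  0 < h -> h <= 1 -> 0 <= del -> dot u u = 1 -> dot (u - e) (u - e) <= del ^+ 2 ->
  `|(A^T *m (tilt_rotation h *m u)) i 0 - (1 + h * (s i - rho)) * (A^T *m u) i 0|
    <= h * (3 * D ^+ 3 * (h + del)).
Proof.
move=> h0 h1 del0 uu ud; rewrite -!dot_col.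
apply: small_rotation_estimate => //.
- exact: qp_direction_unit.
- exact: tilt_direction_orthogonal.
- by rewrite !dot_col tiltE.
Qed.

Lemma tilt_pointwise (eta : R) : 0 < eta ->
  exists g0 h0, [/\ 0 < g0, g0 < q^-1, 0 < h0 &
  forall h t r (u : 'cV[R]_k) i, 0 < h -> h < h0 -> 0 < t -> 0 < r -> dot u u = 1 ->
    (forall j, j \in I -> g0 <= (A^T *m u) j 0) -> i \in I ->
    (t * (1 + h * s i) < r * (A^T *m (tilt_rotation h *m u)) i 0 ->
       t * (1 + h * (rho - eta)) < r * (A^T *m u) i 0) /\
    (t * (1 + h * (rho + eta)) < r * (A^T *m u) i 0 ->
       t * (1 + h * s i) < r * (A^T *m (tilt_rotation h *m u)) i 0)].
Proof.
move=> eta0; have eta_half : `|eta / 2| <= eta by rewrite gtr0_norm ?divr_gt0//; lra.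
(* [b] bounds a_i . u from below on the cap, which turns the additive error of [tilt_estimate] into
   a relative one; C h and C del are each kept below eta b / 4. *)
have D1 := D_ge1; pose b := q^-1 / 2; pose C := 3 * D ^+ 3.
have b0 : 0 < b by rewrite divr_gt0// invr_gt0.
have C0 : 0 < C by rewrite mulr_gt0// exprn_gt0//; lra.
pose del := Num.min 1 (eta * b / (4 * C)).
have z0 : 0 < eta * b / (4 * C) by rewrite divr_gt0// mulr_gt0.
have del0 : 0 < del by rewrite lt_min ltr01.
have del1 : del <= 1 by rewrite ge_min lexx.
have delC : del * (4 * C) <= eta * b.
  have : del <= eta * b / (4 * C) by rewrite ge_min lexx orbT.
  by rewrite ler_pdivlMr// mulr_gt0.
have del2 : del ^+ 2 <= 1 by rewrite expr_le1// ltW.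
have del20 : 0 < del ^+ 2 by rewrite exprn_gt0.
(* [W] bounds the coefficient of h^2 when the common factor is multiplied by [p] below; the
   smallness of h (D + eta) keeps [p] positive. *)
pose W := (`|rho| + eta) * (D + eta).
have De : 0 < D + eta by lra.
have W0 : 0 < W by rewrite mulr_gt0// ltr_wpDl.
pose h0 := Num.min (Num.min (1 / 2) (eta * b / (4 * C)))
                   (Num.min (eta / (2 * W)) (1 / (2 * (D + eta)))).
(* If all a_j . u reach this value, then e . u >= 1 - del^2 / 2, which means |u - e| <= del. *)
exists ((1 - del ^+ 2 / 2) * q^-1), h0; split.
- by rewrite mulr_gt0 ?invr_gt0//; lra.
- by rewrite gtr_pMl ?invr_gt0//; lra.
- have W2 : 0 < eta / (2 * W) by rewrite divr_gt0// mulr_gt0.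
  have D2 : 0 < 1 / (2 * (D + eta)) by rewrite divr_gt0// mulr_gt0.
  by rewrite !lt_min z0 W2 D2 divr_gt0.
move=> h t r u i h_gt0; rewrite !lt_min => /andP[/andP[h1 h2] /andP[h3 h4]] t0 r0 uu ug iI.
have hC : h * (4 * C) < eta * b by move: h2; rewrite ltr_pdivlMr// mulr_gt0.
have hW : h * (2 * W) < eta by move: h3; rewrite ltr_pdivlMr// mulr_gt0.
have hD : h * (2 * (D + eta)) < 1 by move: h4; rewrite ltr_pdivlMr// mulr_gt0.
set y := (A^T *m u) i 0; set Y := (A^T *m (tilt_rotation h *m u)) i 0.
have yb : b <= y.
  apply: le_trans (ug _ iI); rewrite /b mulrC ler_pM2r ?invr_gt0//; lra.
have ud : dot (u - e) (u - e) <= del ^+ 2.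
  rewrite dist_unit//; last exact: qp_direction_unit.
  have := gauge_le_dot ug; rewrite mulrCA divff ?gt_eqF// mulr1; lra.
have est : `|Y - (1 + h * (s i - rho)) * y| <= h * (eta / 2 * y).
  apply: le_trans (tilt_estimate _ _ _ _ uu ud) _ => //; [lra|exact: ltW|].
  apply: ler_wpM2l; first exact: ltW.
  apply: (@le_trans _ _ (eta / 2 * b)); last by rewrite ler_wpM2l//; lra.
  rewrite -/C; lra.
have m1 := D_ge i.
move: est; rewrite ler_norml => /andP[e1 e2].
have hm : `|h * (s i - rho)| <= h * D by rewrite normrM gtr0_norm// ler_wpM2l// ltW.
move: (hm); rewrite ler_norml => /andP[m2 m3].
have y0 : 0 < y by lra.
have cross (v m' : R) : `|v| <= `|rho| + eta -> `|m'| <= D + eta ->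
    `|h * (v * m')| <= eta / 2.
  move=> vv mm; rewrite normrM gtr0_norm// normrM.
  apply: (@le_trans _ _ (h * W)); last by lra.
  by apply: ler_wpM2l; [exact: ltW|exact: ler_pM].
split=> H.
(* Here Y <= p y and p (1 + h (rho - eta)) <= 1 + h s_i: one half of eta pays for the error of the
   rotation, the other for the term in h^2. The second inclusion is symmetric. *)
- pose p := 1 + h * (s i - rho + eta / 2).
  have p0 : 0 < p by rewrite /p; nra.
  rewrite -(ltr_pM2r p0).
  have : `|h * ((rho - eta) * (s i - rho + eta / 2))| <= eta / 2.
    apply: cross; first by apply: le_trans (ler_normB _ _) _; rewrite lerD2l gtr0_norm.
    by apply: le_trans (ler_normD _ _) _; rewrite lerD.
  rewrite ler_norml => /andP[_ c2].
  apply: (@le_lt_trans _ _ (t * (1 + h * s i))).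
    rewrite -mulrA; apply: ler_wpM2l; first exact: ltW.
    have := ler_wpM2l (ltW h_gt0) c2; rewrite /p; lra.
  apply: (lt_le_trans H); rewrite -mulrA; apply: ler_wpM2l; first exact: ltW.
  rewrite /p; lra.
- pose p := 1 + h * (s i - rho - eta / 2).
  have p0 : 0 < p by rewrite /p; nra.
  have : `|h * ((rho + eta) * (s i - rho - eta / 2))| <= eta / 2.
    apply: cross; first by apply: le_trans (ler_normD _ _) _; rewrite lerD2l gtr0_norm.
    by apply: le_trans (ler_normB _ _) _; rewrite lerD.
  rewrite ler_norml => /andP[c1 _].
  apply: (@lt_le_trans _ _ (r * y * p)); last first.
    rewrite -mulrA; apply: ler_wpM2l; first exact: ltW.
    rewrite /p; lra.
  move: H; rewrite -(ltr_pM2r p0) => /(le_lt_trans _); apply.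
  rewrite -mulrA; apply: ler_wpM2l; first exact: ltW.
  have := ler_wpM2l (ltW h_gt0) c1; rewrite /p; lra.
Qed.

(** The rotation moves a component by O(h) only, so one that is at most g0 cannot get past g1. [B]
    bounds - s_i, and [E] collects the first-order coefficients in g0 + h (D + 3 C) <= g1 (1 - h
    B). *)
Lemma tilt_off (g0 g1 : R) : 0 < g0 -> g0 < g1 -> exists2 h0, 0 < h0 &
  forall h t r (u : 'cV[R]_k) i, 0 < h -> h < h0 -> 0 < t -> 0 < r -> dot u u = 1 ->
    (A^T *m u) i 0 <= g0 ->
    t * (1 + h * s i) < r * (A^T *m (tilt_rotation h *m u)) i 0 -> t < r * g1.
Proof.
move=> g00 g01; have D1 := D_ge1; pose C := 3 * D ^+ 3; pose B := `|rho| + D.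
have C0 : 0 < C by rewrite mulr_gt0// exprn_gt0//; lra.
have B1 : 1 <= B by rewrite /B; have := normr_ge0 rho; lra.
pose E := D + 3 * C + g1 * B + 1.
have gB : 0 < g1 * B by rewrite mulr_gt0//; lra.
have E0 : 0 < E by rewrite /E; lra.
exists (Num.min (Num.min 1 (1 / (2 * B))) ((g1 - g0) / E)).
  by rewrite !lt_min ltr01 !divr_gt0 ?mulr_gt0//; lra.
move=> h t r u i h_gt0; rewrite !lt_min => /andP[/andP[h1 h2] h3] t0 r0 uu yg.
have hB : h * (2 * B) < 1 by move: h2; rewrite ltr_pdivlMr// mulr_gt0//; lra.
have hE : h * E < g1 - g0 by move: h3; rewrite ltr_pdivlMr.
set y := (A^T *m u) i 0 in yg *; set Y := (A^T *m (tilt_rotation h *m u)) i 0 => H.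
(* Here u need not be near e; 2 is the diameter of the sphere. *)
have ud : dot (u - e) (u - e) <= 2 ^+ 2.
  rewrite dist_unit//; last exact: qp_direction_unit.
  have := dot_unit_le1 qp_direction_unit uu; rewrite ler_norml => /andP[w1 _].
  rewrite expr2; lra.
have y1 : `|y| <= 1 by rewrite /y -dot_col dot_unit_le1.
have : `|Y - (1 + h * (s i - rho)) * y| <= h * (C * (h + 2)).
  by apply: tilt_estimate => //; exact: ltW.
rewrite ler_norml => /andP[_ e2].
have my : (s i - rho) * y <= D.
  apply: le_trans (ler_norm _) _; rewrite -[leRHS]mulr1; exact: normrM_le.
have hmy := ler_wpM2l (ltW h_gt0) my.
have hC : h * (C * (h + 2)) <= h * (3 * C).
  by apply: ler_wpM2l; [exact: ltW|nra].
have Y1 : Y <= g0 + h * (D + 3 * C) by lra.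
have sB : - B <= s i.
  have := D_ge i; rewrite ler_norml => /andP[d1 _].
  have : - `|rho| <= rho by rewrite lerNl -normrN ler_norm.
  rewrite /B; lra.
have hs := ler_wpM2l (ltW h_gt0) sB.
have p0 : 0 < 1 - h * B by lra.
rewrite -(ltr_pM2r p0).
apply: (@le_lt_trans _ _ (t * (1 + h * s i))).
  by apply: ler_wpM2l; [exact: ltW|lra].
apply: (lt_le_trans H); rewrite -mulrA; apply: ler_wpM2l; first exact: ltW.
apply: (le_trans Y1); move: hE; rewrite /E; lra.
Qed.

End tilted_direction.

(** * Orthant probabilities of elliptical vectors *)

Lemma fine_le_ae (R : realType) d (T : measurableType d) (P : probability T R)
    (E E' : set T) : measurable E -> measurable E' ->
  {ae P, forall t, E t -> E' t} -> fine (P E) <= fine (P E').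
Proof.
move=> mE mE' [N [mN PN sub]]; apply: fine_le; rewrite ?fin_num_measure//.
rewrite -[leRHS]adde0 -PN; apply: le_trans (measureU2 _ mE' mN).
apply: le_measure; rewrite ?inE//; first exact: measurableU.
move=> t Et; have [E't|nE't] := pselect (E' t); [by left|right].
by apply: sub => /= h; apply: nE't; exact: h.
Qed.

Lemma fine_le_ae_add (R : realType) d (T : measurableType d) (P : probability T R)
    (E E1 E2 : set T) : measurable E -> measurable E1 -> measurable E2 ->
  {ae P, forall t, E t -> E1 t \/ E2 t} -> fine (P E) <= fine (P E1) + fine (P E2).
Proof.
move=> mE mE1 mE2 sub; rewrite -fineD ?fin_num_measure//.
apply: (@le_trans _ _ (fine (P (E1 `|` E2)))).
  by apply: fine_le_ae => //; exact: measurableU.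
apply: fine_le; rewrite ?fin_numD ?fin_num_measure//; first exact: measurableU.
exact: measureU2.
Qed.

Section elliptic.
Context {R : realType} {k : nat} {d : measure_display} {T : measurableType d}
  {P : probability T R} (Z : {RV P >-> R}) (U : 'I_k -> {RV P >-> R}) (A : 'M[R]_k).

Let rU := rtuple (fun i t => U i t).
Let G x := 1 - cdfR Z x.

Lemma tailE x : P [set t | x < Z t] = (G x)%:E.
Proof.
have mZ : measurable (Z @^-1` `]-oo, x]%classic).
  by rewrite -[X in measurable X]setTI; exact: measurable_funPT.
have -> : [set t | x < Z t] = ~` (Z @^-1` `]-oo, x]%classic).
  apply/seteqP; split => t /=; rewrite in_itv/=; first by move=> xZ; apply/negP; rewrite -ltNge.
  by move/negP; rewrite -ltNge.
rewrite probability_setC// /G /cdfR /cdf.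
have fin : P (Z @^-1` `]-oo, x]%classic) \is a fin_num by rewrite fin_num_measure.
by rewrite -{1}(fineK fin).
Qed.

Lemma measurable_tail x : measurable [set t | x < Z t].
Proof. by apply: measurable_ltr_set => //; exact: measurable_funPT. Qed.

Lemma fine_tail x : fine (P [set t | x < Z t]) = G x.
Proof. by rewrite tailE. Qed.

Lemma tail_noninc : nonincreasing_fun G.
Proof.
move=> x y xy; rewrite -!fine_tail; apply: fine_le_ae; [exact: measurable_tail..|].
by apply: aeW => t /=; apply: le_lt_trans.
Qed.

Lemma tail_le1 x : G x <= 1.
Proof.
rewrite -fine_tail -lee_fin fineK ?fin_num_measure ?probability_le1//;
exact: measurable_tail.
Qed.

Lemma tail_cvg0 : G x @[x --> +oo] --> 0.
Proof.
have E : G = fine \o ccdf Z.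
  apply/funext => x; rewrite -fine_tail /= /ccdf; congr (fine (P _)).
  by apply/seteqP; split => t /=; rewrite in_itv/= andbT.
rewrite E; apply: fine_cvg; exact: cvg_ccdfy0.
Qed.

Definition orthant_event (I : {set 'I_k}) (tau : 'I_k -> R) : set (k.-tuple R * R) :=
  [set p | forall i, i \in I -> tau i < p.2 * (A^T *m tvec p.1) i 0].

Lemma measurable_orthant_event I tau : measurable (orthant_event I tau).
Proof.
rewrite [X in measurable X](_ : _ = \bigcap_(i in [set i | i \in I])
    [set p : k.-tuple R * R | tau i < p.2 * (A^T *m tvec p.1) i 0]).
  apply: fin_bigcap_measurable => // i _; apply: measurable_ltr_set => //.
  apply: measurable_funM => //.
  apply: (measurableT_comp (f := fun v : k.-tuple R => (A^T *m tvec v) i 0)) => //.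
  exact: measurable_mulmx_tvec.
by apply/seteqP; split => p /= h i; apply: h.
Qed.

(** The unit norm is part of the event because it holds only almost surely, whereas the conditional
    comparison is made for each fixed direction. *)
Definition cap_event (I : {set 'I_k}) (g : R) : set (k.-tuple R * R) :=
  [set p | dot (tvec p.1) (tvec p.1) = 1 /\
           forall i, i \in I -> g <= (A^T *m tvec p.1) i 0].

Lemma measurable_cap_event I g : measurable (cap_event I g).
Proof.
rewrite [X in measurable X](_ : _ =
    [set p : k.-tuple R * R | dot (tvec p.1) (tvec p.1) = 1] `&`
    \bigcap_(i in [set i | i \in I])
      ~` [set p : k.-tuple R * R | (A^T *m tvec p.1) i 0 < g]); last first.
  apply/seteqP; split => p /=.
    by move=> [p1 h]; split => // i iI /=; apply/negP; rewrite -leNgt; exact: h.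
  by move=> [p1 h]; split => // i iI; rewrite leNgt; apply/negP; exact: h.
apply: measurableI.
  have m1 : measurable_fun [set: k.-tuple R * R] (fun p => dot (tvec p.1) (tvec p.1)).
    rewrite (_ : (fun p => _) = (fun v => dot (tvec v - 0) (tvec v - 0)) \o fst).
      by apply: measurableT_comp => //; exact: measurable_dot_tvec.
    by apply/funext => p /=; rewrite subr0.
  by have := m1 measurableT _ (measurable_set1 1); rewrite setTI.
apply: fin_bigcap_measurable => // i _; apply: measurableC; apply: measurable_ltr_set => //.
apply: (measurableT_comp (f := fun v : k.-tuple R => (A^T *m tvec v) i 0)) => //.
exact: measurable_mulmx_tvec.
Qed.

Let mUZ (S : set (k.-tuple R * R)) (V : T -> k.-tuple R) :
  measurable_fun [set: T] V -> measurable S -> measurable [set t | S (V t, Z t)].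
Proof.
move=> mV mS; have mVZ : measurable_fun [set: T] (fun t => (V t, Z t)).
  by apply: measurable_fun_pair => //; exact: measurable_funPT.
by have := mVZ measurableT _ mS; rewrite setTI.
Qed.

Definition orthant_prob (I : {set 'I_k}) (tau : 'I_k -> R) : R :=
  fine (P [set t | forall i, i \in I -> tau i < Z t * mulmx_vec A^T (fun j s => U j s) i t]).

Lemma orthant_probE I tau :
  orthant_prob I tau = fine (P [set t | orthant_event I tau (rU t, Z t)]).
Proof.
congr (fine (P _)); apply/seteqP.
by split => t /= h i iI; have := h i iI; rewrite /= tvec_rtuple.
Qed.

Let mrU : measurable_fun [set: T] rU.
Proof. exact: measurable_rU. Qed.

(** For a fixed direction in the cap, the orthant event with a common threshold tau is Z > tau / g
    with g the smallest component over [I], so comparing radial tails suffices. *)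
Lemma cap_orthant_le (I : {set 'I_k}) (g0 tau1 tau2 C : R) :
  independent_of_vector Z U -> I != finset.set0 -> 0 <= C -> 0 < g0 -> 0 < tau2 ->
  (forall (u : 'cV[R]_k) g, dot u u = 1 -> g0 <= g ->
     (forall i, i \in I -> g <= (A^T *m u) i 0) -> G (tau1 / g) <= C * G (tau2 / g)) ->
  fine (P [set t | (cap_event I g0 `&` orthant_event I (fun=> tau1)) (rU t, Z t)]) <=
  C * fine (P [set t | (cap_event I g0 `&` orthant_event I (fun=> tau2)) (rU t, Z t)]).
Proof.
move=> ZU /set0Pn[j0 j0I] C0 g00 tau20 GC.
have mS tau : measurable (cap_event I g0 `&` orthant_event I (fun=> tau)).
  by apply: measurableI; [exact: measurable_cap_event|exact: measurable_orthant_event].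
have fin S : measurable S -> P [set t | S (rU t, Z t)] \is a fin_num.
  by move=> ?; rewrite fin_num_measure//; exact: mUZ.
rewrite -lee_fin EFinM !fineK ?fin//.
apply: (conditional_le ZU) => // v.
have mv tau : measurable
    [set t | (cap_event I g0 `&` orthant_event I (fun=> tau)) (v, Z t)].
  by apply: (@mUZ _ (fun=> v)); [exact: measurable_cst|exact: mS].
(* The 0 is a dummy: [cap_event] does not look at the radius. *)
have [capv|ncapv] := pselect (cap_event I g0 (v, 0)); last first.
  rewrite [X in (P X <= _)%E](_ : _ = set0).
    by rewrite measure0 mule_ge0.
  by apply/seteqP; split => t //= -[cv _]; apply: ncapv.
set u := tvec v in capv; case: (capv) => /= uu ug.
have [i0 i0I i0min] : exists2 i0, i0 \in I & forall i, i \in I ->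
    (A^T *m u) i0 0 <= (A^T *m u) i 0.
  by case: (arg_minP (fun i => (A^T *m u) i 0) j0I) => i0 ? ?; exists i0.
set g := (A^T *m u) i0 0 in i0min.
have g0g : g0 <= g by exact: ug.
have gpos : 0 < g by exact: lt_le_trans g0g.
have h := GC u g uu g0g i0min.
apply: (@le_trans _ _ (C%:E * P [set t | (tau2 / g < Z t)%R])%E).
  apply: (@le_trans _ _ (P [set t | (tau1 / g < Z t)%R])); last first.
    by rewrite !tailE -EFinM lee_fin.
  apply: le_measure; rewrite ?inE; [exact: mv|exact: measurable_tail|].
  by move=> t [_ /(_ i0 i0I)] /=; rewrite -/u -/g ltr_pdivrMr.
apply: lee_wpmul2l; first by rewrite lee_fin.
apply: le_measure; rewrite ?inE; [exact: measurable_tail|exact: mv|].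
move=> t /=; rewrite ltr_pdivrMr// => h2; split; first exact: capv.
move=> i iI /=; rewrite -/u; apply: (lt_le_trans h2).
apply: ler_wpM2l; last exact: i0min.
by rewrite -(pmulr_lge0 _ gpos); apply: ltW; exact: lt_trans h2.
Qed.

(** The a_i are unit vectors, so directions within b - g of e still have components at least g; p is
    the positive probability of that ball, split off by independence. *)
Lemma orthant_prob_ge (I : {set 'I_k}) (e : 'cV[R]_k) (g b : R) :
  uniform_on_sphere U -> independent_of_vector Z U ->
  (forall i, (A^T *m A) i i = 1) -> dot e e = 1 -> 0 < g -> g < b ->
  (forall i, i \in I -> b <= (A^T *m e) i 0) ->
  exists2 p : R, 0 < p & forall tau : R, 0 < tau ->
    p * G (tau / g) <= orthant_prob I (fun=> tau).
Proof.
move=> Uu ZU Adiag ee g0 gb eb; pose r := (b - g) ^+ 2.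
have r0 : 0 < r by rewrite exprn_gt0// subr_gt0.
have mB : measurable (rU @^-1` ball_around e r).
  by rewrite -[X in measurable X]setTI; apply: mrU => //; exact: measurable_ball_around.
exists (fine (P (rU @^-1` ball_around e r))).
  by apply: fine_gt0; rewrite cap_gt0//= -ge0_fin_numE// fin_num_measure.
move=> tau tau0; rewrite orthant_probE.
pose B := `](tau / g : R), +oo[%classic.
have E : P ((Z @^-1` B) `&` (rU @^-1` ball_around e r)) =
    (P (Z @^-1` B) * P (rU @^-1` ball_around e r))%E.
  by apply: ZU; [exact: measurable_itv|]; apply: rtuple_preimage_gen; exact: measurable_ball_around.
have ZE : Z @^-1` B = [set t | tau / g < Z t].
  by apply/seteqP; split => t; rewrite /B /= in_itv/= andbT.
rewrite ZE in E.
rewrite mulrC -(fine_tail (tau / g)) -fineM; last 2 first.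
- by rewrite fin_num_measure//; exact: measurable_tail.
- by rewrite fin_num_measure.
rewrite -E; apply: fine_le_ae.
- by apply: measurableI => //; exact: measurable_tail.
- by apply: mUZ => //; exact: measurable_orthant_event.
apply: aeW => t [/= tauZ]; rewrite /ball_around /= => near i iI /=.
have Zt : 0 < Z t by apply: lt_trans tauZ; rewrite divr_gt0.
rewrite ltr_pdivrMr// in tauZ; apply: (lt_le_trans tauZ).
apply: ler_wpM2l; first exact: ltW.
set u := tvec (rU t) in near *.
have col_unit : dot (col i A) (col i A) <= 1 ^+ 2.
  rewrite expr1n -(Adiag i) dotE mxE; apply: ler_sum => j _.
  by rewrite !mxE.
have : `|dot (col i A) (u - e)| <= 1 * (b - g).
  by apply: dot_le => //; [rewrite subr_ge0; exact: ltW|exact: ltW].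
have dc (v : 'cV[R]_k) : dot (col i A) v = (A^T *m v) i 0.
  by rewrite /dot tr_col -row_mul mxE.
rewrite dotDr dotNr !dc mul1r ler_norml => /andP[h _].
by have := eb _ iI; lra.
Qed.

Hypothesis A_unit : A \in unitmx.
Hypothesis A_diag : forall i, (A^T *m A) i i = 1.
Hypothesis U_unif : uniform_on_sphere U.
Hypothesis Z_gt0 : {ae P, forall t, 0 < Z t}.
Hypothesis ZU : independent_of_vector Z U.

Let good_ae : {ae P, forall t, dot (tvec (rU t)) (tvec (rU t)) = 1 /\ 0 < Z t}.
Proof.
apply: filterS2 Z_gt0 U_unif.1 => t Zt Ut; split => //.
by rewrite -Ut dotE tvec_rtuple; apply: eq_bigr => i _; rewrite mxE expr2.
Qed.

Lemma orthant_prob_rotation (I : {set 'I_k}) tau (B : 'M[R]_k) : B^T *m B = 1%:M ->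
  orthant_prob I tau =
  fine (P [set t | forall i, i \in I -> tau i < Z t * (A^T *m (B *m tvec (rU t))) i 0]).
Proof.
move=> BB; rewrite orthant_probE; congr fine.
rewrite -(rotation_invariant ZU U_unif BB (measurable_orthant_event I tau)).
congr (P _); apply/seteqP.
have E t : tvec (rtuple (mulmx_vec B (fun i t => U i t)) t) = B *m tvec (rU t).
  by rewrite !tvec_rtuple; apply/colP => j; rewrite [LHS]mxE.
by split => t /= h i iI; have := h i iI; rewrite /= E.
Qed.

Let measurable_rotated (I : {set 'I_k}) (tau : 'I_k -> R) (B : 'M[R]_k) :
  measurable [set t | forall i, i \in I -> tau i < Z t * (A^T *m (B *m tvec (rU t))) i 0].
Proof.
rewrite [X in measurable X](_ : _ = \bigcap_(i in [set i | i \in I])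
    [set t | tau i < Z t * (A^T *m (B *m tvec (rU t))) i 0]).
  apply: fin_bigcap_measurable => // i _; apply: measurable_ltr_set => //.
  apply: measurable_funM; first exact: measurable_funPT.
  apply: (measurableT_comp (f := fun v : k.-tuple R => (A^T *m (B *m tvec v)) i 0)) => //.
  under eq_fun do rewrite mulmxA; exact: measurable_mulmx_tvec.
by apply/seteqP; split => p /= h i; apply: h.
Qed.

Context (w : R -> R) (theta : R).
Hypothesis F0 : cdfR Z 0 = 0.
Hypothesis F_lt1 : forall x : R, 0 < x -> cdfR Z x < 1.
Hypothesis w_gt0 : forall u : R, 0 < u -> 0 < w u.
Hypothesis F_gumbel : forall x : R,
  (1 - cdfR Z (u + x / w u)) / (1 - cdfR Z u) @[u --> +oo] --> expR (- x).
Hypothesis w_rv : forall a : R, 0 < a ->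
  w (a * u) / w u @[u --> +oo] --> a `^ (theta - 1).

Lemma tail_gt0 x : 0 < G x.
Proof.
have [x0|x0] := ltP 0 x; first by rewrite subr_gt0 F_lt1.
apply: (@lt_le_trans _ _ (G 1)); first by rewrite subr_gt0 F_lt1.
by apply: tail_noninc; apply: le_trans x0 _.
Qed.

Lemma tail_neg x : x < 0 -> G x = 1.
Proof.
move=> x0; apply/eqP; rewrite eq_le tail_le1/=.
have <- : G 0 = 1 by rewrite /G F0 subr0.
by apply: tail_noninc; exact: ltW.
Qed.

(** * Shifted thresholds for one index set *)

Section fixed_index_set.
Context (I : {set 'I_k}) (c : 'cV[R]_k) (s : 'I_k -> R).
Hypothesis I_neq0 : I != finset.set0.
Hypothesis c_dual : qp_dual (A^T *m A) I c.

Let q := Num.sqrt (qp_value c).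
Let rho := tilt c s.

Lemma orthant_prob_gt0 t : 0 < t -> 0 < orthant_prob I (fun=> t).
Proof.
move=> t0.
have q0 : 0 < q by rewrite sqrtr_gt0 (qp_value_gt0 A_unit I_neq0 c_dual).
have [|||p p0 hp] := @orthant_prob_ge I (qp_direction A c) (q^-1 / 2) q^-1 U_unif ZU A_diag
  (qp_direction_unit A_unit I_neq0 c_dual).
- by rewrite divr_gt0// invr_gt0.
- have : 0 < q^-1 by rewrite invr_gt0.
  lra.
- by move=> i; exact: (qp_direction_ge A_unit I_neq0 c_dual).
by apply: lt_le_trans (hp _ t0); rewrite mulr_gt0// tail_gt0.
Qed.

(* [core] is the event that [U] is close to [e]; off it the radius exceeds
   [t / g1], which is negligible against [orthant_prob_ge] at [g2 > g1]. *)
Lemma orthant_prob_tilt (eta delta : R) : 0 < eta -> 0 < delta ->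
  \forall t \near +oo,
    expR (- ((rho + eta) * q `^ theta + eta)) * ((1 - delta) * orthant_prob I (fun=> t))
      <= orthant_prob I (fun i => t + s i / w t)
      <= (expR (- ((rho - eta) * q `^ theta - eta)) + delta) * orthant_prob I (fun=> t).
Proof.
move=> eta0 delta0.
have q0 : 0 < q by rewrite sqrtr_gt0 (qp_value_gt0 A_unit I_neq0 c_dual).
have qV0 : 0 < q^-1 by rewrite invr_gt0.
have [d1 d10 hd1] := tail_shift_unif tail_gt0 tail_noninc w_gt0 F_gumbel w_rv (rho - eta) eta0 q0.
have [d2 d20 hd2] := tail_shift_unif tail_gt0 tail_noninc w_gt0 F_gumbel w_rv (rho + eta) eta0 q0.
pose dd := Num.min d1 d2.
have dd0 : 0 < dd by rewrite lt_min d10.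
have [g00 [h0 [g000 g00q h00 tp]]] := tilt_pointwise s A_unit A_diag I_neq0 c_dual eta0.
rewrite -/q in g00q.
(* The second term keeps 1 / g within [q, q + dd], where the uniform tail comparison holds. *)
pose g0 := Num.max g00 (q + dd)^-1.
have g0pos : 0 < g0 by rewrite lt_max g000.
have g0q : g0 < q^-1.
  by rewrite gt_max g00q ltf_pV2 ?posrE ?addr_gt0// ltrDl.
(* These trisect the interval from g0 to 1 / q: room is needed above g0 for the rotation, below 1 /
   q for a ball of directions, and in between for rapid variation. *)
pose g1 := (2 * g0 + q^-1) / 3; pose g2 := (g0 + 2 * q^-1) / 3.
have g01 : g0 < g1 by rewrite /g1; lra.
have g12 : g1 < g2 by rewrite /g1 /g2; lra.
have g2q : g2 < q^-1 by rewrite /g2; lra.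
have g1pos : 0 < g1 by lra.
have g2pos : 0 < g2 by lra.
have [h1 h10 toff] := tilt_off s A_unit A_diag I_neq0 c_dual g0pos g01.
have [p p0 hp] := @orthant_prob_ge I (qp_direction A c) g2 q^-1 U_unif ZU A_diag
  (qp_direction_unit A_unit I_neq0 c_dual) g2pos g2q
  (qp_direction_ge A_unit I_neq0 c_dual).
have g2V : 0 < g2^-1 by rewrite invr_gt0.
have g12V : g2^-1 < g1^-1 by rewrite ltf_pV2.
have dp0 : 0 < delta * p by rewrite mulr_gt0.
have rapid := tail_rapid tail_gt0 tail_noninc tail_neg tail_cvg0 w_gt0 F_gumbel
  g2V g12V dp0.
have twy := scaling_cvg_pinfty tail_gt0 tail_neg tail_cvg0 w_gt0 F_gumbel.
near=> t.
have t0 : 0 < t by near: t; exact: nbhs_pinfty_gt.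
have wt := w_gt0 t0.
pose h := (t * w t)^-1.
have h_gt0 : 0 < h by rewrite invr_gt0 mulr_gt0.
have hM (a : R) : 0 < a -> a^-1 < t * w t -> h < a.
  by move=> a0; rewrite -ltf_pV2 ?posrE ?invr_gt0 ?mulr_gt0// invrK.
have hh0 : h < h0 by apply: hM => //; near: t; exact: (cvgryPgt _).1 twy _.
have hh1 : h < h1 by apply: hM => //; near: t; exact: (cvgryPgt _).1 twy _.
have hE (x : R) : t + x / w t = t * (1 + h * x).
  by rewrite /h; field; rewrite !gt_eqF.
have tau_pos : 0 < t + (rho + eta) / w t.
  rewrite hE mulr_gt0//.
  have r1 : 0 < `|rho + eta| + 1 by rewrite ltr_wpDl.
  have : h < (`|rho + eta| + 1)^-1.
    apply: hM; first by rewrite invr_gt0.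
    by near: t; exact: (cvgryPgt _).1 twy _.
  rewrite -div1r ltr_pdivlMr// => hr.
  have : - (h * `|rho + eta|) <= h * (rho + eta).
    by rewrite -mulrN; apply: ler_wpM2l; [exact: ltW|rewrite lerNl -normrN ler_norm].
  lra.
have range (u : 'cV[R]_k) g : dot u u = 1 -> g0 <= g ->
    (forall i, i \in I -> g <= (A^T *m u) i 0) -> q <= g^-1 <= q + dd.
  move=> uu g0g gu; have gpos : 0 < g by exact: lt_le_trans g0g.
  have gq : g <= q^-1 := gauge_le A_unit I_neq0 c_dual uu gu.
  rewrite -[X in X <= _ <= _]invrK lef_pV2 ?posrE// gq/=.
  rewrite -[leRHS]invrK lef_pV2 ?posrE ?invr_gt0 ?addr_gt0//.
  by apply: le_trans g0g; rewrite le_max lexx orbT.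
have bd1 : forall l, q <= l <= q + d1 ->
    expR (- ((rho - eta) * q `^ theta + eta)) * G (l * t) <=
      G (l * (t + (rho - eta) / w t)) <=
    expR (- ((rho - eta) * q `^ theta - eta)) * G (l * t) by near: t.
have bd2 : forall l, q <= l <= q + d2 ->
    expR (- ((rho + eta) * q `^ theta + eta)) * G (l * t) <=
      G (l * (t + (rho + eta) / w t)) <=
    expR (- ((rho + eta) * q `^ theta - eta)) * G (l * t) by near: t.
have far : G (t / g1) <= delta * orthant_prob I (fun=> t).
  apply: (@le_trans _ _ (delta * p * G (g2^-1 * t))).
    by rewrite mulrC; near: t.
  by rewrite -mulrA; apply: ler_wpM2l; [exact: ltW|rewrite (mulrC g2^-1) hp].
pose core tau := fine (P [set x | (cap_event I g0 `&` orthant_event I (fun=> tau)) (rU x, Z x)]).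
have mcore tau : measurable
    [set x | (cap_event I g0 `&` orthant_event I (fun=> tau)) (rU x, Z x)].
  apply: mUZ => //.
  by apply: measurableI; [exact: measurable_cap_event|exact: measurable_orthant_event].
have mfull tau : measurable [set x | orthant_event I tau (rU x, Z x)].
  by apply: mUZ => //; exact: measurable_orthant_event.
have BB := tilt_rotation_orthogonal s A_unit I_neq0 c_dual h.
have mrot := measurable_rotated I (fun i => t + s i / w t) (tilt_rotation A c s h).
have g00g0 : g00 <= g0 by rewrite le_max lexx.
apply/andP; split.
- rewrite (orthant_prob_rotation I (fun i => t + s i / w t) BB).
  have split_core : (1 - delta) * orthant_prob I (fun=> t) <= core t.
    suff h' : orthant_prob I (fun=> t) <= core t + G (t / g1).
      by rewrite mulrBl mul1r lerBlDr (le_trans h')// lerD2l.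
    rewrite orthant_probE -(fine_tail (t / g1)).
    apply: fine_le_ae_add => //; first exact: measurable_tail.
    apply: filterS good_ae => x [xx Zx] hx.
    have [hc|/existsNP[i /not_implyP[iI /negP]]] :=
      pselect (forall i, i \in I -> g0 <= (A^T *m tvec (rU x)) i 0); first by left.
    rewrite -ltNge => lo; right; rewrite /= ltr_pdivrMr//.
    apply: (lt_trans (hx i iI)) => /=; rewrite ltr_pM2l//; exact: lt_trans g01.
  apply: (@le_trans _ _ (expR (- ((rho + eta) * q `^ theta + eta)) * core t)).
    by apply: ler_wpM2l => //; exact: expR_ge0.
  (* For the lower bound the comparison is reversed: the core at t is bounded by the core at the
     shifted threshold, with the inverse exponential as factor. *)
  rewrite mulrC -ler_pdivlMr ?expR_gt0// -expRN mulrC.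
  apply: (@le_trans _ _ (expR (- - ((rho + eta) * q `^ theta + eta)) *
      core (t + (rho + eta) / w t))).
    apply: cap_orthant_le => //.
    move=> u g uu g0g gu; have /andP[r1 r2] := range u g uu g0g gu.
    rewrite expRN ler_pdivlMl ?expR_gt0//.
    rewrite !(mulrC _ g^-1); have [|//] := andP (bd2 g^-1 _).
    rewrite r1/=; apply: le_trans r2 _; rewrite lerD2l /dd ge_min lexx orbT//.
  apply: ler_wpM2l; first exact: expR_ge0.
  apply: fine_le_ae => //.
  apply: filterS good_ae => x [xx Zx] [[_ hc] ho] i iI.
  rewrite hE; apply: (tp h t (Z x) (tvec (rU x)) i h_gt0 hh0 t0 Zx xx _ iI).2.
    by move=> j jI; apply: le_trans (hc j jI).
  by rewrite -hE; exact: ho.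
- rewrite (orthant_prob_rotation I (fun i => t + s i / w t) BB) mulrDl.
  apply: (@le_trans _ _ (core (t + (rho - eta) / w t) + G (t / g1))).
    rewrite -(fine_tail (t / g1)).
    apply: fine_le_ae_add => //; first exact: measurable_tail.
    apply: filterS good_ae => x [xx Zx] hx.
    have [hc|/existsNP[i /not_implyP[iI /negP]]] :=
      pselect (forall i, i \in I -> g0 <= (A^T *m tvec (rU x)) i 0).
      left; split => // i iI /=; rewrite hE.
      apply: (tp h t (Z x) (tvec (rU x)) i h_gt0 hh0 t0 Zx xx _ iI).1.
        by move=> j jI; apply: le_trans (hc j jI).
      by rewrite -hE; exact: hx.
    rewrite -ltNge => lo; right; rewrite /= ltr_pdivrMr//.
    apply: (toff h t (Z x) (tvec (rU x)) i h_gt0 hh1 t0 Zx xx); first exact: ltW.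
    by rewrite -hE; exact: hx.
  apply: lerD => //.
  apply: (@le_trans _ _ (expR (- ((rho - eta) * q `^ theta - eta)) * core t)).
    apply: cap_orthant_le => //.
    move=> u g uu g0g gu; have /andP[r1 r2] := range u g uu g0g gu.
    rewrite !(mulrC _ g^-1); have [|//] := andP (bd1 g^-1 _).
    rewrite r1/=; apply: le_trans r2 _; rewrite lerD2l /dd ge_min lexx//.
  apply: ler_wpM2l; first exact: expR_ge0.
  rewrite orthant_probE; apply: fine_le_ae => //.
  by apply: aeW => x [].
Unshelve. all: by end_near. Qed.

Lemma orthant_prob_ratio :
  orthant_prob I (fun i => t + s i / w t) / orthant_prob I (fun=> t) @[t --> +oo] -->
  expR (- (rho * qp_value c `^ (theta / 2))).
Proof.
have V0 := qp_value_gt0 A_unit I_neq0 c_dual.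
have qE : q `^ theta = qp_value c `^ (theta / 2).
  by rewrite /q -powR12_sqrt ?ltW// -powRrM mulrC.
rewrite -qE; set E := q `^ theta; set L := expR _.
have E0 : 0 <= E by exact: powR_ge0.
have L0 : 0 < L by exact: expR_gt0.
apply/cvgrPdist_lt => eps eps0.
pose m := Num.min (eps / 2) (L / 2).
have m0 : 0 < m by rewrite lt_min !divr_gt0.
have me : m <= eps / 2 by rewrite ge_min lexx.
have mL : m <= L / 2 by rewrite ge_min lexx orbT.
have LmN : 0 < L - m by lra.
(* Factors exp(kap) and exp(- kap) keep L within m. The exponents of [orthant_prob_tilt] are off by
   eta E + eta, whence the division by E + 1. *)
pose kap := Num.min (ln ((L + m) / L)) (ln (L / (L - m))).
have kap0 : 0 < kap.
  by rewrite lt_min; apply/andP; split; rewrite ln_gt0// ltr_pdivlMr//; lra.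
pose eta := kap / (E + 1).
have E1 : 0 < E + 1 by lra.
have eta0 : 0 < eta by rewrite divr_gt0.
have etaE : eta * E + eta = kap by rewrite -[X in _ + X]mulr1 -mulrDr divfK// gt_eqF.
(* [delta] enters the upper bound additively and the lower one multiplied by at most L. *)
pose delta := Num.min (eps / 4) (eps / (4 * L)).
have delta0 : 0 < delta by rewrite lt_min !divr_gt0// mulr_gt0.
have de : delta <= eps / 4 by rewrite ge_min lexx.
have dL : delta * L <= eps / 4.
  have : delta <= eps / (4 * L) by rewrite ge_min lexx orbT.
  rewrite ler_pdivlMr ?mulr_gt0//; lra.
have up : expR (- ((rho - eta) * E - eta)) <= L + m.
  have -> : - ((rho - eta) * E - eta) = - (rho * E) + kap by rewrite -etaE; ring.
  rewrite expRD -/L mulrC -ler_pdivlMr//.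
  rewrite -[leRHS]lnK ?posrE ?divr_gt0//; last lra.
  by rewrite ler_expR ge_min lexx.
have lo : L - m <= expR (- ((rho + eta) * E + eta)).
  have -> : - ((rho + eta) * E + eta) = - (rho * E) - kap by rewrite -etaE; ring.
  rewrite expRD -/L expRN ler_pdivlMr ?expR_gt0// mulrC -ler_pdivlMr//.
  rewrite -[leRHS]lnK ?posrE ?divr_gt0//.
  by rewrite ler_expR ge_min lexx orbT.
have loL : expR (- ((rho + eta) * E + eta)) <= L.
  by rewrite ler_expR; have := mulr_ge0 (ltW eta0) E0; lra.
near=> t.
have t0 : 0 < t by near: t; exact: nbhs_pinfty_gt.
have H0 := orthant_prob_gt0 t0.
have /andP[] : expR (- ((rho + eta) * E + eta)) * ((1 - delta) * orthant_prob I (fun=> t))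
      <= orthant_prob I (fun i => t + s i / w t)
      <= (expR (- ((rho - eta) * E - eta)) + delta) * orthant_prob I (fun=> t).
  by near: t; exact: orthant_prob_tilt.
rewrite mulrA -ler_pdivlMr// => b1; rewrite -ler_pdivrMr// => b2.
set a := expR _ in loL lo b1; set b := expR _ in up b2.
have a0 : delta * a <= delta * L by apply: ler_wpM2l => //; exact: ltW.
rewrite ltr_norml; apply/andP; split; lra.
Unshelve. all: by end_near. Qed.

End fixed_index_set.
Definition component (i : 'I_k) (t : T) : R :=
  Z t * mulmx_vec A^T (fun j s => U j s) i t.

Lemma measurable_component i : measurable_fun [set: T] (component i).
Proof.
apply: measurable_funM; first exact: measurable_funPT.
exact: measurable_mulmx_vec.
Qed.

Lemma measurable_components (I : {set 'I_k}) (f g : 'I_k -> R -> R) :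
  (forall i, measurable_fun [set: R] (f i)) -> (forall i, measurable_fun [set: R] (g i)) ->
  measurable [set t | forall i, i \in I -> f i (component i t) < g i (component i t)].
Proof.
move=> mf mg; rewrite [X in measurable X](_ : _ = \bigcap_(i in [set i | i \in I])
    [set t | f i (component i t) < g i (component i t)]).
  apply: fin_bigcap_measurable => // i _; apply: measurable_ltr_set;
    by apply: measurableT_comp => //; exact: measurable_component.
by apply/seteqP; split => p /= h i; apply: h.
Qed.

(** * Passing to the quantile scale *)

Section common_quantile.
Context (i1 : 'I_k).

Lemma delta_qp_dual : qp_dual (A^T *m A) (finset.set1 i1) (delta_mx i1 0).
Proof.
split => i.
- by rewrite mxE; case: (_ && _).
- by rewrite inE mxE => /negbTE->.
- by rewrite inE => /eqP->; rewrite -colE mxE A_diag.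
- by rewrite mxE andbT; case: eqP => [->|]; rewrite ?ltxx// -colE mxE A_diag.
Qed.

(** [i1] is the component whose distribution function plays the role of Q for all components. *)
Definition marginal_tail (y : R) : R := orthant_prob (finset.set1 i1) (fun=> y).

Let Qb := marginal_tail.

Let i1_neq0 : (finset.set1 i1) != finset.set0.
Proof. by apply/set0Pn; exists i1; rewrite inE. Qed.

Lemma marginal_tailE y : Qb y = fine (P [set t | y < component i1 t]).
Proof.
congr (fine (P _)); apply/seteqP; split => t /=; first by apply; rewrite inE.
by move=> h i; rewrite inE => /eqP->.
Qed.

Let mQ y : measurable [set t | y < component i1 t].
Proof. by apply: measurable_ltr_set => //; exact: measurable_component. Qed.

Lemma marginal_tail_noninc : nonincreasing_fun Qb.
Proof.
move=> x y xy; rewrite !marginal_tailE; apply: fine_le_ae => //.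
by apply: aeW => t /=; apply: le_lt_trans.
Qed.

Lemma marginal_tail_gt0 y : 0 < Qb y.
Proof.
apply: (@lt_le_trans _ _ (Qb (Num.max y 1))).
  by apply: (orthant_prob_gt0 i1_neq0 delta_qp_dual); rewrite lt_max ltr01 orbT.
by apply: marginal_tail_noninc; rewrite le_max lexx.
Qed.

Lemma marginal_tail_cvg0 : Qb y @[y --> +oo] --> 0.
Proof.
pose Y : {RV P >-> R} := mfun_Sub (mem_set (measurable_component i1)).
have -> : Qb = fine \o ccdf Y.
  apply/funext => y; rewrite marginal_tailE /= /ccdf; congr (fine (P _)).
  by apply/seteqP; split => t /=; rewrite in_itv/= andbT.
apply: fine_cvg; exact: cvg_ccdfy0.
Qed.

(** For a single index the unit diagonal makes the value of the programme 1 and the tilt equal to x,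
    so the power of alpha disappears. *)
Lemma marginal_tail_gumbel (x : R) :
  Qb (t + x / w t) / Qb t @[t --> +oo] --> expR (- x).
Proof.
have := @orthant_prob_ratio _ _ (fun=> x) i1_neq0 delta_qp_dual.
have sum_delta (f : 'I_k -> R) :
    \sum_i (delta_mx i1 0 : 'cV[R]_k) i 0 * f i = f i1.
  rewrite (bigD1 i1)//= mxE !eqxx mul1r big1 ?addr0// => i ii1.
  by rewrite mxE (negbTE ii1) mul0r.
have v1 : qp_value (delta_mx i1 0) = 1 :> R.
  by rewrite /qp_value -[RHS](sum_delta (fun=> 1)); apply: eq_bigr => i _; rewrite mulr1.
by rewrite /tilt v1 sum_delta divr1 powR1 mulr1.
Qed.

Let level (u : R) : set R := [set y | u^-1 <= Qb y].

(** A supremum requires neither continuity nor strict monotonicity of the tail; only strict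
    inequalities on either side of it are used. *)
Definition quantile (u : R) : R := sup (level u).

Let level_bounded u : 0 < u -> has_ubound (level u).
Proof.
move=> u0; have : \forall y \near +oo, Qb y < u^-1.
  by apply: (cvgr_lt _ marginal_tail_cvg0); rewrite invr_gt0.
move=> [M [_ HM]]; exists (M + 1) => y yu; rewrite leNgt; apply/negP => My.
have : Qb y < u^-1 by apply: HM; apply: lt_trans My; rewrite ltrDl.
by apply/negP; rewrite -leNgt.
Qed.

Lemma quantile_lt u y : 0 < u -> quantile u < y -> Qb y < u^-1.
Proof.
move=> u0 uy; rewrite ltNge; apply/negP => Hy.
have : y <= quantile u by apply: ub_le_sup => //; exact: level_bounded.
by apply/negP; rewrite -ltNge.
Qed.

Lemma quantile_ge u y : level u !=set0 -> y < quantile u -> u^-1 <= Qb y.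
Proof.
move=> l0 yu; have [y' ly' yy'] := sup_gt l0 yu.
by apply: le_trans ly' _; apply: marginal_tail_noninc; exact: ltW.
Qed.

Let level_near M : \forall u \near +oo, level u M.
Proof.
near=> u; have u0 : 0 < u by near: u; exact: nbhs_pinfty_gt.
have uM : (Qb M)^-1 <= u by near: u; exact/nbhs_pinfty_ge/num_real.
by rewrite /level /= -[leRHS]invrK lef_pV2 ?posrE ?invr_gt0 ?marginal_tail_gt0.
Unshelve. all: by end_near. Qed.

Lemma quantile_cvg : quantile u @[u --> +oo] --> +oo.
Proof.
apply/cvgryPge => M; near=> u.
have u0 : 0 < u by near: u; exact: nbhs_pinfty_gt.
by apply: ub_le_sup; [exact: level_bounded|near: u; exact: level_near].
Unshelve. all: by end_near. Qed.

(** The tail at the quantile b itself need not be 1 / u, so 1 / u is compared with the tail at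
    distance (eps / 3) / w(b) from b; the remaining part of eps absorbs the limits. *)
Lemma quantile_shift (x eps : R) : 0 < x -> 0 < eps ->
  \forall u \near +oo, Qb (quantile u + (- ln x + eps) / w (quantile u)) < x / u
    < Qb (quantile u + (- ln x - eps) / w (quantile u)).
Proof.
move=> x0 eps0.
have lt_near y a : expR (- y) < a ->
    \forall u \near +oo, Qb (quantile u + y / w (quantile u)) < a * Qb (quantile u).
  move=> ya; apply: (quantile_cvg (t := fun t => Qb (t + y / w t) < a * Qb t)).
  apply: filterS (cvgr_lt _ (@marginal_tail_gumbel y) _ ya) => t.
  by rewrite ltr_pdivrMr ?marginal_tail_gt0.
have gt_near y a : a < expR (- y) ->
    \forall u \near +oo, a * Qb (quantile u) < Qb (quantile u + y / w (quantile u)).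
  move=> ya; apply: (quantile_cvg (t := fun t => a * Qb t < Qb (t + y / w t))).
  apply: filterS (cvgr_gt _ (@marginal_tail_gumbel y) _ ya) => t.
  by rewrite ltr_pdivlMr ?marginal_tail_gt0.
have e1 : expR (- (- ln x + eps)) < x * expR (- (2 / 3 * eps)).
  by rewrite -[X in X * _]lnK ?posrE// -expRD ltr_expR; lra.
have e2 : x * expR (2 / 3 * eps) < expR (- (- ln x - eps)).
  by rewrite -[X in X * _]lnK ?posrE// -expRD ltr_expR; lra.
have e3 : expR (- (2 / 3 * eps)) < expR (- (eps / 3)) by rewrite ltr_expR; lra.
have e4 : expR (- - (eps / 3)) < expR (2 / 3 * eps) by rewrite ltr_expR; lra.
near=> u.
have u0 : 0 < u by near: u; exact: nbhs_pinfty_gt.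
have b0 : 0 < quantile u by near: u; exact: (cvgryPgt _).1 quantile_cvg _.
have wb := w_gt0 b0.
have s0 : 0 < eps / 3 / w (quantile u) by rewrite !divr_gt0.
apply/andP; split.
- apply: (@lt_trans _ _ (x * expR (- (2 / 3 * eps)) * Qb (quantile u))).
    by near: u; exact: lt_near.
  rewrite -mulrA ltr_pM2l//.
  apply: (@lt_trans _ _ (Qb (quantile u + eps / 3 / w (quantile u)))).
    by near: u; exact: gt_near.
  by apply: quantile_lt => //; rewrite ltrDl.
- apply: (@lt_trans _ _ (x * expR (2 / 3 * eps) * Qb (quantile u))); last first.
    by near: u; exact: gt_near.
  rewrite -mulrA ltr_pM2l//.
  apply: (@le_lt_trans _ _ (Qb (quantile u + (- (eps / 3)) / w (quantile u)))).
    apply: quantile_ge; first by exists 0; near: u; exact: level_near.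
    by rewrite mulNr ltrBlDr ltrDl.
  by near: u; exact: lt_near.
Unshelve. all: by end_near. Qed.

Definition exceedance (I : {set 'I_k}) (u : R) (x : 'I_k -> R) : R :=
  fine (P [set t | forall i, i \in I -> Qb (component i t) < x i / u]).

Let measurable_Qb : measurable_fun [set: R] Qb.
Proof. exact: nonincreasing_measurable marginal_tail_noninc. Qed.

Let measurable_exceedance (I : {set 'I_k}) (u : R) (x : 'I_k -> R) :
  measurable [set t | forall i, i \in I -> Qb (component i t) < x i / u].
Proof. by apply: (@measurable_components I (fun=> Qb) (fun i => cst (x i / u))). Qed.

Let measurable_orthant (I : {set 'I_k}) (tau : 'I_k -> R) :
  measurable [set t | forall i, i \in I -> tau i < component i t].
Proof. by apply: (@measurable_components I (fun i => cst (tau i)) (fun=> id)). Qed.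

Section exceedance_limit.
Context (I : {set 'I_k}) (c : 'cV[R]_k).
Hypothesis I_neq0 : I != finset.set0.
Hypothesis c_dual : qp_dual (A^T *m A) I c.

Lemma exceedance_gt0 (u : R) (x : 'I_k -> R) :
  0 < u -> (forall i, 0 < x i) -> 0 < exceedance I u x.
Proof.
move=> u0 x0.
have [M [_ HM]] : \forall y \near +oo, forall i, Qb y < x i / u.
  apply: filter_forall => i.
  by apply: (cvgr_lt _ marginal_tail_cvg0); rewrite divr_gt0.
pose y := Num.max (M + 1) 1.
have y0 : 0 < y by rewrite lt_max ltr01 orbT.
have My : M < y by rewrite lt_max ltrDl ltr01.
apply: lt_le_trans (orthant_prob_gt0 I_neq0 c_dual y0) _.
apply: fine_le_ae => //; apply: aeW => t h i iI.
apply: le_lt_trans (HM _ My i); apply: marginal_tail_noninc.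
by apply: ltW; exact: h.
Qed.

Let shifted (s : 'I_k -> R) (t : R) := orthant_prob I (fun i => t + s i / w t).

Let E := qp_value c `^ (theta / 2).

Let shifted_ratio (s1 s2 : 'I_k -> R) :
  shifted s1 t / shifted s2 t @[t --> +oo] --> expR (E * (tilt c s2 - tilt c s1)).
Proof.
have r1 := @orthant_prob_ratio _ _ s1 I_neq0 c_dual.
have r2 := @orthant_prob_ratio _ _ s2 I_neq0 c_dual.
have -> : expR (E * (tilt c s2 - tilt c s1)) =
    expR (- (tilt c s1 * E)) / expR (- (tilt c s2 * E)).
  by rewrite -expRN -expRD; congr expR; ring.
have r2V : (orthant_prob I (fun i => t + s2 i / w t) / orthant_prob I (fun=> t))^-1
    @[t --> +oo] --> (expR (- (tilt c s2 * E)))^-1.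
  by apply: cvgV => //; rewrite gt_eqF// expR_gt0.
apply: (cvg_trans _ (cvgM r1 r2V)); apply: near_eq_cvg.
near=> t.
have t0 : 0 < t by near: t; exact: nbhs_pinfty_gt.
have H0 := orthant_prob_gt0 I_neq0 c_dual t0.
have S0 : 0 < orthant_prob I (fun i => t + s2 i / w t) / orthant_prob I (fun=> t).
  by near: t; apply: (cvgr_gt _ r2); exact: expR_gt0.
rewrite pmulr_lgt0 ?invr_gt0// in S0.
by rewrite /shifted /=; field; rewrite !gt_eqF.
Unshelve. all: by end_near. Qed.

(** The weights c_i / alpha add up to 1. *)
Let tiltD (s : 'I_k -> R) (a : R) : tilt c (fun i => s i + a) = tilt c s + a.
Proof.
rewrite /tilt; under eq_bigr do rewrite mulrDr.
rewrite big_split/= -mulr_suml mulrDl mulrAC divff ?mul1r//.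
by rewrite gt_eqF// (qp_value_gt0 A_unit I_neq0 c_dual).
Qed.

(** At the quantile, each exceedance probability lies between orthant probabilities with shifts - ln
    x_i + eps and - ln x_i - eps; in the ratio this costs a factor exp(2 E eps). *)
Lemma exceedance_ratio (x : 'I_k -> R) : (forall i, 0 < x i) ->
  exceedance I u x / exceedance I u (fun=> 1) @[u --> +oo] -->
  expR (- (E * tilt c (fun i => - ln (x i)))).
Proof.
move=> x0.
have E0 : 0 <= E by exact: powR_ge0.
have sandwich y eps : (forall i, 0 < y i) -> 0 < eps -> \forall u \near +oo,
    shifted (fun i => - ln (y i) + eps) (quantile u) <= exceedance I u y
    <= shifted (fun i => - ln (y i) - eps) (quantile u).
  move=> y0 eps0.
  have H : \forall u \near +oo, forall i,
      Qb (quantile u + (- ln (y i) + eps) / w (quantile u)) < y i / u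
      < Qb (quantile u + (- ln (y i) - eps) / w (quantile u)).
    by apply: filter_forall => i; exact: quantile_shift.
  apply: filterS H => u h.
  apply/andP; split; apply: fine_le_ae => //; apply: aeW => t /= ht i iI;
      have /andP[h1 h2] := h i.
    by apply: le_lt_trans h1; apply: marginal_tail_noninc; apply: ltW; exact: ht.
  rewrite ltNge; apply/negP => h3.
  have := ht i iI; apply/negP; rewrite -leNgt.
  by apply: le_trans (ltW h2) _; exact: marginal_tail_noninc.
set L := expR _; have L0 : 0 < L by exact: expR_gt0.
have shift_limit eps : expR (E * (tilt c (fun i => - ln 1 + eps) -
    tilt c (fun i => - ln (x i) - eps))) = L * expR (E * (2 * eps)).
  rewrite !tiltD /L -expRD; congr expR.
  have -> : tilt c (fun=> - ln 1) = 0 :> R.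
    by rewrite /tilt big1 ?mul0r// => i _; rewrite ln1 oppr0 mulr0.
  ring.
have ex0 y u : (forall i, 0 < y i) -> 0 < u -> 0 < exceedance I u y.
  by move=> y0 u0; exact: exceedance_gt0.
have pos_near y eps : (forall i, 0 < y i) -> 0 < eps ->
    \forall u \near +oo, 0 < shifted (fun i => - ln (y i) + eps) (quantile u).
  move=> y0 eps0; apply: (quantile_cvg (t := fun t => 0 < shifted _ t)).
  have r := @orthant_prob_ratio _ _ (fun i => - ln (y i) + eps) I_neq0 c_dual.
  near=> t; have t0 : 0 < t by near: t; exact: nbhs_pinfty_gt.
  have H0 := orthant_prob_gt0 I_neq0 c_dual t0.
  rewrite -(pmulr_lgt0 _ (_ : 0 < (orthant_prob I (fun=> t))^-1)) ?invr_gt0//.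
  by near: t; apply: (cvgr_gt _ r); exact: expR_gt0.
have pick a : L < a -> exists2 eps, 0 < eps & L * expR (E * (2 * eps)) < a.
  move=> La; have E2 : 0 < E + 1 by lra.
  have E1 : 0 < 2 * (E + 1) by lra.
  have l0 : 0 < ln (a / L) by rewrite ln_gt0// ltr_pdivlMr// mul1r.
  exists (ln (a / L) / (2 * (E + 1))); first by rewrite divr_gt0.
  rewrite mulrC -ltr_pdivlMr// -[ltRHS]lnK ?posrE ?divr_gt0//; last lra.
  rewrite ltr_expR; set l := ln _ in l0 *.
  have -> : E * (2 * (l / (2 * (E + 1)))) = l * (E / (E + 1)) by field; rewrite gt_eqF.
  by rewrite gtr_pMr// ltr_pdivrMr//; lra.
apply/cvgrPdist_lt => e e0.
pose m := Num.min (e / 2) (L / 2).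
have m0 : 0 < m by rewrite lt_min !divr_gt0.
have me : m < e.
  by apply: (@le_lt_trans _ _ (e / 2)); [rewrite ge_min lexx|lra].
have mL : m <= L / 2 by rewrite ge_min lexx orbT.
have Lm0 : 0 < L - m by lra.
(* [eps1] serves the upper bound of the ratio and [eps2] the lower: L^2 / (L - m) is the value for
   which the inverse factor exp(- 2 E eps2) leaves L above L - m. *)
have [|eps1 eps10 h1] := pick (L + m); first lra.
have [|eps2 eps20 h2] := pick (L * L / (L - m)).
  by rewrite ltr_pdivlMr// ltr_pM2l//; lra.
have h2' : L - m < L * expR (E * (2 * (- eps2))).
  have -> : E * (2 * (- eps2)) = - (E * (2 * eps2)) by ring.
  move: h2; rewrite expRN ltr_pdivlMr// ltr_pdivlMr ?expR_gt0// => h2.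
  rewrite -(ltr_pM2l L0); lra.
near=> u.
have u0 : 0 < u by near: u; exact: nbhs_pinfty_gt.
have x_pos := ex0 x u x0 u0; have one_pos := ex0 (fun=> 1) u (fun=> ltr01) u0.
have /andP[a1 a2] : shifted (fun i => - ln (x i) + eps2) (quantile u) <= exceedance I u x
    <= shifted (fun i => - ln (x i) - eps1) (quantile u).
  apply/andP; split.
    by have /andP[] : shifted (fun i => - ln (x i) + eps2) (quantile u) <= exceedance I u x
      <= shifted (fun i => - ln (x i) - eps2) (quantile u) by near: u; exact: sandwich.
  by have /andP[] : shifted (fun i => - ln (x i) + eps1) (quantile u) <= exceedance I u x
    <= shifted (fun i => - ln (x i) - eps1) (quantile u) by near: u; exact: sandwich.
have /andP[b1 b2] : shifted (fun i => - ln 1 + eps1) (quantile u) <= exceedance I u (fun=> 1)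
    <= shifted (fun i => - ln 1 - eps2) (quantile u).
  apply/andP; split.
    by have /andP[] : shifted (fun i => - ln 1 + eps1) (quantile u) <= exceedance I u (fun=> 1)
      <= shifted (fun i => - ln 1 - eps1) (quantile u) by near: u; exact: (sandwich (fun=> 1)).
  by have /andP[] : shifted (fun i => - ln 1 + eps2) (quantile u) <= exceedance I u (fun=> 1)
    <= shifted (fun i => - ln 1 - eps2) (quantile u) by near: u; exact: (sandwich (fun=> 1)).
have up : shifted (fun i => - ln (x i) - eps1) (quantile u) /
    shifted (fun i => - ln 1 + eps1) (quantile u) < L + m.
  near: u; apply: (quantile_cvg (t := fun t => shifted _ t / shifted _ t < L + m)).
  by apply: (cvgr_lt _ (@shifted_ratio _ _)); rewrite shift_limit.
have lo : L - m < shifted (fun i => - ln (x i) + eps2) (quantile u) /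
    shifted (fun i => - ln 1 - eps2) (quantile u).
  near: u; apply: (quantile_cvg (t := fun t => L - m < shifted _ t / shifted _ t)).
  apply: (cvgr_gt _ (@shifted_ratio _ _)).
  by have := shift_limit (- eps2); rewrite opprK => ->.
have sp : 0 < shifted (fun i => - ln 1 + eps1) (quantile u).
  by near: u; exact: (pos_near (fun=> 1)).
have r1 : exceedance I u x / exceedance I u (fun=> 1) < L + m.
  apply: le_lt_trans up; apply: ler_pM => //; [exact: ltW|by rewrite invr_ge0 ltW|].
  by rewrite lef_pV2 ?posrE.
have r2 : L - m < exceedance I u x / exceedance I u (fun=> 1).
  apply: lt_le_trans lo _.
  have s2 : 0 < shifted (fun i => - ln (x i) + eps2) (quantile u) by near: u; exact: pos_near.
  have s3 : 0 < shifted (fun i => - ln 1 - eps2) (quantile u) by exact: lt_le_trans b2.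
  apply: ler_pM => //; [exact: ltW|by rewrite invr_ge0 ltW|].
  by rewrite lef_pV2 ?posrE.
rewrite distrC ltr_distl; apply/andP; split.
  by apply: lt_trans r2; rewrite ltrD2l ltrN2.
by apply: (lt_trans r1); rewrite ltrD2l.
Unshelve. all: by end_near. Qed.

End exceedance_limit.
End common_quantile.
End elliptic.

(** * Bounds on the value of the programme *)

Section correlation_programme.
Context {R : realType} {k : nat} (A : 'M[R]_k) (I : {set 'I_k}) (c : 'cV[R]_k).
Hypothesis A_unit : A \in unitmx.
Hypothesis A_diag : forall i, (A^T *m A) i i = 1.
Hypothesis I_neq0 : I != finset.set0.
Hypothesis c_dual : qp_dual (A^T *m A) I c.

Let Sigma := A^T *m A.

(** This is |a_i - z|^2 with z = A c. As a_i . z >= 1 for i in [I], its non-negativity gives alpha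
    >= 1, and alpha = 1 forces a_i = z. *)
Lemma gram_delta i : dot (delta_mx i 0 - c) (Sigma *m (delta_mx i 0 - c)) =
  1 - 2 * (Sigma *m c) i 0 + qp_value c.
Proof.
have dE (v : 'cV[R]_k) : dot (delta_mx i 0) v = v i 0.
  rewrite dotE (bigD1 i)//= mxE !eqxx mul1r big1 ?addr0// => j ji.
  by rewrite mxE (negbTE ji) mul0r.
rewrite mulmxBr !(dotDl, dotNl, dotDr, dotNr) (qp_dual_dotE c_dual) !dE.
rewrite -(dot_mulmxS (gram_sym A) c (delta_mx i 0)) (dotC (_ *m c)) dE.
by rewrite -colE mxE A_diag /qp_value /Sigma; ring.
Qed.

Lemma dot_gram_ge0 (u : 'cV[R]_k) : 0 <= dot u (Sigma *m u).
Proof. by rewrite dot_gram dot_ge0. Qed.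

Lemma qp_value_ge1 : 1 <= qp_value c.
Proof.
have /set0Pn[i iI] := I_neq0.
have z1 : 1 <= (Sigma *m c) i 0 by case: c_dual => _ _ + _; exact.
have := dot_gram_ge0 (delta_mx i 0 - c); rewrite gram_delta; lra.
Qed.

(** Otherwise two distinct columns of the invertible matrix would both equal z. *)
Lemma qp_value_gt1 : (1 < #|I|)%N -> 1 < qp_value c.
Proof.
move=> /card_gt1P[i [j [iI jI ij]]]; rewrite lt_neqAle qp_value_ge1 andbT eq_sym.
apply/eqP => v1.
have E l : l \in I -> delta_mx l 0 = c.
  move=> lI; apply/eqP; rewrite -subr_eq0; apply: contraT => /(gram_pos A_unit).
  rewrite gram_delta v1.
  by have z1 : 1 <= (Sigma *m c) l 0 by [case: c_dual => _ _ + _; exact]; lra.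
have /matrixP/(_ i 0) := etrans (E i iI) (esym (E j jI)).
by rewrite !mxE !eqxx (negbTE ij) => /eqP; rewrite oner_eq0.
Qed.

Lemma qform_ones : ((ones R #|I|)^T *m inv_ones Sigma I) 0 0 = qform Sigma I (ones R k).
Proof.
rewrite /qform /inv_ones -mulmxA.
by have -> : subvec_set (ones R k) I = ones R #|I| by apply/colP => a; rewrite !mxE.
Qed.

Let ones_feasible : qp_feasible I (ones R k).
Proof. by move=> i _; rewrite mxE. Qed.

Lemma qp_value_le_ones : qp_value c <= qform Sigma I (ones R k).
Proof. exact: (qform_ge (gram_sym A) (gram_pos A_unit) c_dual ones_feasible). Qed.

(** In case of equality the all-ones vector is a minimiser, the gap vanishes, and Sigma c = 1 on the
    whole of [I], so no constraint in [M] is slack. *)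
Lemma qp_value_lt_ones : let K := support c in let M := I :\: K in
  submx_set Sigma M K *m inv_ones Sigma K != ones R #|M| ->
  qp_value c < qform Sigma I (ones R k).
Proof.
move=> K M; rewrite lt_neqAle qp_value_le_ones andbT; apply: contra => /eqP v1.
have [d Sd gap] := qform_gap (gram_sym A) (gram_pos A_unit) c_dual ones_feasible.
have dc : d = c.
  apply/eqP; rewrite -subr_eq0; apply: contraT => /(gram_pos A_unit).
  by move: gap; rewrite -v1 /qp_value subrr => /le_lt_trans h /h; rewrite ltxx.
rewrite (qp_dual_inv_ones (gram_pos A_unit) c_dual).
rewrite submx_set_mul; last exact: qp_dual_supported c_dual.
apply/eqP/colP => b; rewrite -dc [LHS]mxE Sd ?mxE//.
by have := enum_valP b; rewrite !inE => /andP[].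
Qed.

End correlation_programme.

(** * Transfer from the vector X to its radial representation *)

Section elliptic_law.
Context {R : realType} {k : nat} {d : measure_display} {T : measurableType d}
  {P : probability T R} (X : 'I_k -> {RV P >-> R})
  {d' : measure_display} {T' : measurableType d'} {P' : probability T' R}
  (Z : {RV P' >-> R}) (U : 'I_k -> {RV P' >-> R}) (A : 'M[R]_k).
Hypothesis XZU : eq_in_dist P P' (fun i t => X i t)
  (fun i t => Z t * mulmx_vec A^T (fun j s => U j s) i t).

Lemma cdf_marginal_tail i y : cdfR (X i) y = 1 - marginal_tail Z U A i y.
Proof.
have mY := measurable_component Z U A i.
have mle : measurable [set t | component Z U A i t <= y].
  rewrite (_ : mkset _ = component Z U A i @^-1` `]-oo, y]%classic).
    by rewrite -[X in measurable X]setTI; exact: mY.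
  by apply/seteqP; split => t /=; rewrite in_itv.
have -> : cdfR (X i) y = fine (P' [set t | component Z U A i t <= y]).
  rewrite /cdfR /cdf /distribution /pushforward; congr fine.
  have mB : measurable [set v : k.-tuple R | tnth v i <= y].
    rewrite (_ : mkset _ = (@tnth _ R ^~ i) @^-1` `]-oo, y]%classic).
      by rewrite -[X in measurable X]setTI; exact: measurable_tnth.
    by apply/seteqP; split => v /=; rewrite in_itv.
  have := eq_in_dist_measure _ (measurable_component Z U A) XZU mB.
  have E (S : Type) (Y : 'I_k -> S -> R) :
      rtuple Y @^-1` [set v | tnth v i <= y] = [set t | Y i t <= y].
    by apply/seteqP; split => t /=; rewrite tnth_mktuple.
  by rewrite !E => <-.
rewrite marginal_tailE.
have -> : [set t | y < component Z U A i t] = ~` [set t | component Z U A i t <= y].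
  by apply/seteqP; split => t /=; [move=> h; apply/negP|move/negP]; rewrite -ltNge.
have fin : P' [set t | component Z U A i t <= y] \is a fin_num by rewrite fin_num_measure.
by rewrite probability_setC// -{2}(fineK fin) -EFinB /= opprB addrC subrK.
Qed.

(** The event is a Borel condition on the vector because Q is monotone, so equality in distribution
    carries it over; there Q > 1 - x_i / u reads as the marginal tail being below x_i / u. *)
Lemma S_tilde_exceedance i (I : {set 'I_k}) u (x : 'cV[R]_k) :
  S_tilde X (cdfR (X i)) I u x = exceedance Z U A i I u (fun j => x j 0).
Proof.
have mQ : measurable_fun [set: R] (cdfR (X i)).
  apply: nondecreasing_measurable => // y z yz.
  by rewrite !cdf_marginal_tail lerB// marginal_tail_noninc.
rewrite /S_tilde /exceedance; congr fine.
have mB : measurable [set v : k.-tuple R |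
    forall j, j \in I -> 1 - x j 0 / u < cdfR (X i) (tnth v j)].
  rewrite [X in measurable X](_ : _ = \bigcap_(j in [set j | j \in I])
      [set v : k.-tuple R | 1 - x j 0 / u < cdfR (X i) (tnth v j)]).
    apply: fin_bigcap_measurable => // j _; apply: measurable_ltr_set => //.
    by apply: measurableT_comp => //; exact: measurable_tnth.
  by apply/seteqP; split => v /= h j; apply: h.
have := eq_in_dist_measure _ (measurable_component Z U A) XZU mB.
have E (S : Type) (Y : 'I_k -> S -> R) : rtuple Y @^-1` [set v : k.-tuple R |
    forall j, j \in I -> 1 - x j 0 / u < cdfR (X i) (tnth v j)] =
    [set t | forall j, j \in I -> 1 - x j 0 / u < cdfR (X i) (Y j t)].
  by apply/seteqP; split => t /= h j jI; have := h j jI; rewrite tnth_mktuple.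
rewrite !E => ->; last by move=> j; exact: measurable_funPT.
by congr (P' _); apply/seteqP; split => t /= h j jI; have := h j jI;
  rewrite cdf_marginal_tail ltrD2l ltrN2.
Qed.

End elliptic_law.

Theorem theorem4p1 (R : realType) (k : nat) (hk : (2 <= k)%N)
  (d : measure_display) (T : measurableType d) (P : probability T R)
  (X : 'I_k -> {RV P >-> R})
  (d' : measure_display) (T' : measurableType d') (P' : probability T' R)
  (rad : {RV P' >-> R}) (U : 'I_k -> {RV P' >-> R})
  (A : 'M[R]_k) (w : R -> R) (theta : R) :
  let Sigma := A^T *m A in
  let F := cdfR rad in
  let Q := cdfR (X (first_index hk)) in
  let S := S_tilde X Q in
  A \in unitmx ->
  uniform_on_sphere U ->
  {ae P', forall t, 0 < rad t} ->
  independent_of_vector rad U ->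
  eq_in_dist P P' (fun i t => X i t)
    (fun i t => rad t * mulmx_vec A^T (fun j s => U j s) i t) ->
  (forall i, Sigma i i = 1) ->
  F 0 = 0 ->
  (forall x, 0 < x -> F x < 1) ->
  (forall u, 0 < u -> 0 < w u) ->
  (forall x : R,
    (1 - F (u + x / w u)) / (1 - F u) @[u --> +oo] --> expR (- x)) ->
  0 <= theta ->
  (forall c : R, 0 < c -> w (c * u) / w u @[u --> +oo] --> c `^ (theta - 1)) ->
  forall I : {set 'I_k}, I != finset.set0 ->
  (exists2 y, qp_feasible I y & qform Sigma I y = qp_min Sigma I) /\
  exists K : {set 'I_k},
  [/\ unique (qp_active_set Sigma I) K,
      (forall a : 'I_#|K|, 0 < gamma_exp Sigma I theta a),
      (forall x : 'cV[R]_k, (forall i, 0 < x i 0) ->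
        S I u x / S I u (ones R k) @[u --> +oo] -->
        \prod_(a < #|K|) x (enum_val a) 0 `^ gamma_exp Sigma I theta a),
      regularly_varying (fun u => S I u (ones R k))
        (- (eta_index Sigma I theta)^-1) &
      let lower := (((ones R #|I|)^T *m inv_ones Sigma I) 0 0) `^ (- (theta / 2)) in
      let M := I :\: K in
      [/\ lower <= eta_index Sigma I theta <= 1,
          (0 < theta -> (1 < #|I|)%N -> eta_index Sigma I theta < 1) &
          (0 < theta -> submx_set Sigma M K *m inv_ones Sigma K != ones R #|M| ->
            lower < eta_index Sigma I theta)]].
Proof.
move=> Sigma F Q S A_unit U_unif rad_gt0 indep XZU A_diag F0 F_lt1 w_gt0 F_gumbel
  theta0 w_rv I I_neq0.
have [c Dc] := qp_dual_exists (gram_sym A) (gram_pos A_unit) I_neq0.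
have alphaE : qp_min Sigma I = qp_value c := qp_minE (gram_sym A) (gram_pos A_unit) Dc.
have alpha0 := qp_value_gt0 A_unit I_neq0 Dc.
have SE u (x : 'cV[R]_k) : S I u x =
    exceedance rad U A (first_index hk) I u (fun j => x j 0).
  exact: S_tilde_exceedance.
have exceed_ratio := @exceedance_ratio _ _ _ _ _ rad U A A_unit A_diag U_unif rad_gt0
  indep w theta F0 F_lt1 w_gt0 F_gumbel w_rv (first_index hk) I c I_neq0 Dc.
have gammaE a : gamma_exp Sigma I theta a =
    qp_value c `^ (theta / 2 - 1) * c (enum_val (A := support c) a) 0.
  rewrite /gamma_exp alphaE (qp_dual_inv_ones (gram_pos A_unit) Dc).
  by rewrite mxE.
split.
  exists (Sigma *m c); first exact: (qp_dual_feasible Dc).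
  by rewrite (qform_qp_dual (gram_pos A_unit) Dc) alphaE.
exists (support c); split.
- split; first exact: (qp_dual_active (gram_pos A_unit) I_neq0 Dc).
  move=> K' /(active_qp_dual (gram_pos A_unit))[c' Dc' ->].
  by rewrite (qp_dual_unique (gram_pos A_unit) Dc Dc').
- move=> a; rewrite gammaE mulr_gt0 ?powR_gt0//.
  by have := enum_valP a; rewrite inE.
- move=> x x0; under eq_fun do rewrite !SE.
  (* [tilt] divides by alpha, which lowers the exponent theta / 2 by one; the sum over all indices
     then shrinks to the support of c. *)
  have -> : \prod_(a < #|support c|) x (enum_val a) 0 `^ gamma_exp Sigma I theta a =
      expR (- (qp_value c `^ (theta / 2) * tilt c (fun i => - ln (x i 0)))).
    have -> : theta / 2 = (theta / 2 - 1) + 1 by ring.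
    rewrite powRD; last by rewrite (gt_eqF alpha0) implybT.
    have tE (f : 'I_k -> R) : qp_value c * tilt c f = \sum_i c i 0 * f i.
      by rewrite /tilt mulrC divfK// gt_eqF.
    rewrite powRr1 ?ltW// -mulrA tE mulr_sumr -sumrN (_ : \sum_i _ =
      \sum_i (qp_value c `^ (theta / 2 - 1) * ln (x i 0)) * c i 0); last first.
      by apply: eq_bigr => i _; ring.
    rewrite (sum_supported _ (qp_dual_supported Dc)) expR_sum.
    apply: eq_bigr => a _; rewrite gammaE -{1}(lnK (x := x _ 0)) ?posrE//.
    by rewrite -expRM; congr expR; ring.
  have -> : (fun u => exceedance rad U A (first_index hk) I u (fun j => x j 0) /
      exceedance rad U A (first_index hk) I u (fun j => ones R k j 0)) =
      (fun u => exceedance rad U A (first_index hk) I u (fun j => x j 0) /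
      exceedance rad U A (first_index hk) I u (fun=> 1)).
    by apply/funext => u; congr (_ / exceedance _ _ _ _ _ _ _); apply/funext => j; rewrite mxE.
  exact: exceed_ratio.
- have S1 u : S I u (ones R k) = exceedance rad U A (first_index hk) I u (fun=> 1).
    by rewrite SE; congr exceedance; apply/funext => j; rewrite mxE.
  split.
    move=> u u0; rewrite S1.
    exact: (exceedance_gt0 A_unit A_diag U_unif indep F_lt1 _ I_neq0 Dc).
  move=> a a0.
  (* Scaling u is the same as a constant level, so regular variation is an instance of the limit
     just proved, with all x_i equal to 1 / a. *)
  have scale u : S I (a * u) (ones R k) =
      exceedance rad U A (first_index hk) I u (fun=> a^-1).
    rewrite S1 /exceedance; congr (fine (P' _)); apply/seteqP.
    by split => t /= h j jI; have := h j jI; rewrite div1r invfM.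
  under eq_fun do rewrite scale S1.
  have := exceed_ratio (fun=> a^-1) (fun=> _).
  rewrite (_ : expR _ = a `^ (- (eta_index Sigma I theta)^-1)); last first.
    rewrite /eta_index alphaE powRN invrK -[in RHS](lnK (x := a)) ?posrE// -expRM.
    congr expR; rewrite /tilt lnV ?posrE// opprK -mulr_suml.
    by rewrite mulrAC divff ?gt_eqF// mul1r; ring.
  by apply; rewrite invr_gt0.
- have alpha1 : 1 <= qp_value c := qp_value_ge1 A_diag I_neq0 Dc.
  have beta1 := qp_value_le_ones A_unit Dc.
  have beta0 : 0 < qform Sigma I (ones R k) := lt_le_trans alpha0 beta1.
  have t2 : 0 <= theta / 2 by rewrite divr_ge0.
  have one : 1 `^ (theta / 2) = 1 :> R by rewrite powR1.
  have nn (y : R) : 0 < y -> y \in Num.nneg by move=> y0; rewrite nnegrE ltW.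
  rewrite /eta_index alphaE qform_ones !powRN; split.
  + apply/andP; split.
      by rewrite lef_pV2 ?posrE ?powR_gt0// ge0_ler_powR// nn.
    rewrite invf_le1 ?powR_gt0// -[leLHS]one.
    by rewrite ge0_ler_powR// nn.
  + move=> t0 I1; rewrite invf_lt1 ?powR_gt0// -[ltLHS]one.
    apply: gt0_ltr_powR; rewrite ?nn ?divr_gt0//.
    exact: (qp_value_gt1 A_unit A_diag I_neq0 Dc I1).
  + move=> t0 Mne; rewrite ltf_pV2 ?posrE ?powR_gt0//.
    apply: gt0_ltr_powR; rewrite ?nn ?divr_gt0//.
    exact: (qp_value_lt_ones A_unit Dc Mne).
Qed.
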